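(* Consider the triangular array: for each $n$, $p_n\ge1$, fixed $\mathbf{X}_n\in\mathbb{R}^{n\times p_n}$, $\beta^0_n\in\mathbb{R}^{p_n}$, $\mathbf{Y}_n=\mathbf{X}_n\beta^0_n+\varepsilon_n$ with $\varepsilon_{n,i}$ i.i.d. $\mathcal{N}(0,\sigma^2)$, $\sigma>0$; Ridge parameters $\lambda_n>0$ with $\Omega_{\min}(\lambda_n)>0$ and $n^{1/2}\|\theta^0_n\|_2\lambda_n\Omega_{\min}(\lambda_n)^{-1/2}\lambda_{\min\neq0}(\hat\Sigma_n)^{-1}\to0$; an estimator $\hat\beta_{\mathrm{init}}$ and constants $\Delta_{j,n}>0$ with $\mathbb{P}[\bigcap_{j=1}^{p_n}\{|a_{n,p;j}(\sigma)\sum_{k\neq j}(P_{\mathbf{X}})_{jk}(\hat\beta_{\mathrm{init};k}-\beta^0_k)|\le\Delta_{j,n}\}]\to1$. Fix $\zeta>0$ and use the corrected p-values $P_{\mathrm{corr};j}=F_Z(P_j+\zeta)$. Then for every $0<\alpha<1$, $\limsup_{n\to\infty}\mathbb{P}[|V_\alpha|>0]\le\alpha$. Furthermore, there exists a sequence $\eta_n\to0$ such that for every sequence $\alpha_n\in(0,1)$ with $\alpha_n\to0$ and $\alpha_n\ge\eta_n$ for all $n$, $\limsup_{n\to\infty}\big(\mathbb{P}[|V_{\alpha_n}|>0]-\alpha_n\big)\le0$.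
   Context: $\hat\Sigma_n=n^{-1}\mathbf{X}_n^T\mathbf{X}_n$; $P_{\mathbf{X}}=\mathbf{X}_n^T(\mathbf{X}_n\mathbf{X}_n^T)^{-}\mathbf{X}_n$ (Moore–Penrose pseudo-inverse); $\theta^0_n=P_{\mathbf{X}}\beta^0_n$; $\Omega(\lambda)=(\hat\Sigma_n+\lambda I)^{-1}\hat\Sigma_n(\hat\Sigma_n+\lambda I)^{-1}$, $\Omega_{\min}(\lambda)=\min_j\Omega_{jj}(\lambda)$; $\lambda_{\min\neq0}(A)$ = smallest nonzero eigenvalue; $a_{n,p;j}(\sigma)=n^{1/2}\sigma^{-1}\Omega_{jj}(\lambda_n)^{-1/2}$. Ridge $\hat\beta=(\hat\Sigma_n+\lambda_nI)^{-1}n^{-1}\mathbf{X}_n^T\mathbf{Y}_n$, $\hat\beta_{\mathrm{corr};j}=\hat\beta_j-\sum_{k\neq j}(P_{\mathbf{X}})_{jk}\hat\beta_{\mathrm{init};k}$. $P_j=2\big(1-\Phi\big((a_{n,p;j}(\sigma)|\hat\beta_{\mathrm{corr};j}|-\Delta_{j,n})_+\big)\big)$, $\Phi$ the standard normal cdf. $F_Z(c)=\mathbb{P}[\min_{1\le j\le p_n}2(1-\Phi(a_{n,p;j}(\sigma)|Z_j|))\le c]$ with $(Z_1,\ldots,Z_{p_n})\sim\mathcal{N}_{p_n}(0,n^{-1}\sigma^2\Omega(\lambda_n))$. $\hat S_\alpha=\{j:P_{\mathrm{corr};j}\le\alpha\}$, $S_0=\{j:\beta^0_{n,j}\neq0\}$,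 and $V_\alpha=\hat S_\alpha\cap S_0^c$ (set of false positives). *)

(* Defs.v *)
From HB Require Import structures.
From mathcomp Require Import all_boot all_order all_algebra.
From mathcomp Require Import all_classical all_reals all_analysis.
Set Implicit Arguments. Unset Strict Implicit. Unset Printing Implicit Defensive.
Import Order.TTheory GRing.Theory Num.Theory.
Import numFieldNormedType.Exports.
Local Open Scope classical_set_scope.
Local Open Scope ring_scope.

Section Defs.
Variable R : realType.

Definition Phi (x : R) : R := fine (normal_prob 0 1 `]-oo, x]).

Definition gauss_law (v : R) : set R -> \bar R :=
  if v == 0 then \d_(0:R) else normal_prob 0 (Num.sqrt v).

Definition iid_normal d (T : measurableType d) (P : probability T R) (n : nat)
  (eps : T -> 'cV[R]_n) (sigma : R) : Prop :=
  (forall i, measurable_fun setT (fun w => eps w i 0)) /\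
  forall A : 'I_n -> set R, (forall i, measurable (A i)) ->
    P [set w | forall i, A i (eps w i 0)] = (\prod_(i < n) normal_prob 0 sigma (A i))%E.

Definition gaussian_vec d (T : measurableType d) (Q : probability T R) (p : nat)
  (Z : T -> 'cV[R]_p) (C : 'M[R]_p) : Prop :=
  (forall j, measurable_fun setT (fun w => Z w j 0)) /\
  forall (u : 'cV[R]_p) (A : set R), measurable A ->
    Q [set w | A ((u^T *m Z w) 0 0)] = gauss_law ((u^T *m C *m u) 0 0) A.

Definition is_MP_inv (m k : nat) (M : 'M[R]_(m, k)) (G : 'M[R]_(k, m)) : Prop :=
  [/\ M *m G *m M = M, G *m M *m G = G, (M *m G)^T = M *m G & (G *m M)^T = G *m M].

Definition Sigma_hat (n p : nat) (X : 'M[R]_(n, p)) : 'M[R]_p :=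
  (n%:R)^-1 *: (X^T *m X).

Definition Omega (n p : nat) (X : 'M[R]_(n, p)) (lam : R) : 'M[R]_p :=
  let A := invmx (Sigma_hat X + lam%:M) in A *m Sigma_hat X *m A.

Definition Omega_min (p : nat) (Om : 'M[R]_p) : R := inf [set Om j j | j in [set: 'I_p]].

Definition lambda_min_nz (p : nat) (S : 'M[R]_p) : R :=
  inf [set a : R | eigenvalue S a /\ a != 0].

(** P_X = X^T (X X^T)^- X, with G the Moore--Penrose inverse of X X^T. *)
Definition PX (n p : nat) (X : 'M[R]_(n, p)) (G : 'M[R]_n) : 'M[R]_p := X^T *m G *m X.

Definition norm2 (p : nat) (v : 'cV[R]_p) : R := Num.sqrt (\sum_j v j 0 ^+ 2).

Definition a_coef (n p : nat) (sigma : R) (Om : 'M[R]_p) (j : 'I_p) : R :=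
  Num.sqrt n%:R / sigma / Num.sqrt (Om j j).

Definition ridge (n p : nat) (X : 'M[R]_(n, p)) (lam : R) (Y : 'cV[R]_n) : 'cV[R]_p :=
  invmx (Sigma_hat X + lam%:M) *m ((n%:R)^-1 *: (X^T *m Y)).

Definition beta_corr (n p : nat) (X : 'M[R]_(n, p)) (G : 'M[R]_n) (lam : R)
  (Y : 'cV[R]_n) (binit : 'cV[R]_p) (j : 'I_p) : R :=
  ridge X lam Y j 0 - \sum_(k | k != j) PX X G j k * binit k 0.

Definition pval (n p : nat) (X : 'M[R]_(n, p)) (G : 'M[R]_n) (lam sigma : R)
  (Delta : 'I_p -> R) (Y : 'cV[R]_n) (binit : 'cV[R]_p) (j : 'I_p) : R :=
  2 * (1 - Phi (Num.max 0 (a_coef n sigma (Omega X lam) j * `|beta_corr X G lam Y binit j|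
                           - Delta j))).

(** F_Z(c) = P[min_j 2(1 - Phi(a_j |Z_j|)) <= c] *)
Definition FZ d (T : measurableType d) (Q : probability T R) (p : nat)
  (Z : T -> 'cV[R]_p) (a : 'I_p -> R) (c : R) : R :=
  fine (Q [set z | exists j, 2 * (1 - Phi (a j * `|Z z j 0|)) <= c]).

End Defs.

(* Main.v *)
(** On the event of the hypothesis on the initial estimator, a null coordinate
    satisfies [a_j |beta_corr_j| - Delta_j <= a_j |N_j| + o(1)], where [N] is the
    noise part of the ridge estimator: the ridge bias
    [- lam (Sigma_hat + lam)^-1 theta0] is at most
    [lam |theta0| / lambda_min_nz Sigma_hat], since [theta0] lies in the range of
    [Sigma_hat].  As [Phi] is 1/2-Lipschitz, the margin [zeta] eventually absorbs
    the [o(1)], and a false positive forces [FZ (min_j 2 (1 - Phi (a_j |N_j|))) <= alpha].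
    This has probability at most [alpha], because [FZ] is the distribution function
    of that minimum.  The resulting bound holds for all [alpha >= 0] at once, so
    [eta := 0] works in the second part.

    The last step needs [N] and [Z] to agree in law on symmetric boxes, while [Z] is
    only known through the laws of its linear forms.  That the linear forms of [N] are
    Gaussian follows by adding the independent coordinates one at a time.  Equality
    of the laws of all linear forms gives equality of the expectations of products
    of cosines [\prod_j cos (t_j z_j)], hence of [\prod_j f_j z_j] for all [f_j] in
    the smallest class of functions that contains the cosines and is closed under
    linear combinations and bounded pointwise limits; this class contains the
    indicators of symmetric intervals. *)
Require Import Defs.
From HB Require Import structures.
From mathcomp Require Import all_boot all_order all_algebra.
From mathcomp Require Import all_classical all_reals all_analysis.
From mathcomp Require Import complex measurable_realfun ring lra.
Import Order.TTheory GRing.Theory Num.Theory.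
Import numFieldNormedType.Exports.
Local Open Scope classical_set_scope.
Local Open Scope ring_scope.
Set Implicit Arguments.
Unset Strict Implicit.
Unset Printing Implicit Defensive.

(** * Linear forms in independent normal variables *)

(** The Radon-Nikodym derivative of a normal law with respect to Lebesgue measure is almost
    everywhere the normal density, so this is a change of variables. *)
Lemma integral_normal_prob (R : realType) (m s : R) (f : R -> \bar R) :
  measurable_fun setT f -> (\int[normal_prob m s]_x `|f x| < +oo)%E ->
  (\int[normal_prob m s]_x f x =
   \int[lebesgue_measure]_x (f x * (normal_pdf m s x)%:E))%E.
Proof.
move=> mf finf.
rewrite -(Radon_Nikodym_change_of_variables (normal_prob_dominates m s))//=; last first.
  by apply/integrableP; split.
apply: ae_eq_integral => //.
- apply: emeasurable_funM => //; apply: (measurable_int lebesgue_measure).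
  by apply: Radon_Nikodym_integrable; exact: normal_prob_dominates.
- apply: emeasurable_funM => //=; apply/measurableT_comp => //=.
  exact: measurable_normal_pdf.
- apply: ae_eqe_mul2l => /=.
  rewrite Radon_NikodymE//=; first exact: normal_prob_dominates.
  move=> abmu; case: cid => /= h [h1 h2 h3].
  apply: integral_ae_eq => //=.
  + by apply/measurable_EFinP; exact: measurable_normal_pdf.
  + by move=> E E01 mE; rewrite -h3.
Qed.


(** Bundles the image measure with its measure structure, so that it can be rescaled and integrated
    against. *)
Definition pushforward_measure (R : realType) d1 d2 (T1 : measurableType d1)
    (T2 : measurableType d2) (m : {measure set T1 -> \bar R}) (f : T1 -> T2)
    (mf : measurable_fun setT f) : {measure set T2 -> \bar R} :=
  measure_function_pushforward__canonical__measure_function_Measure m mf.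

(** Uniqueness of Lebesgue measure: the rescaled image measure gives half-open intervals their
    length. *)
Lemma lebesgue_measure_affine (R : realType) (w c : R) (A : set R) :
  w != 0 -> measurable A ->
  (`|w|%:E * lebesgue_measure [set x | A (w * x + c)%R] = lebesgue_measure A)%E.
Proof.
move=> w0 mA.
have mg : measurable_fun setT ((fun x => w * x + c) : measurableTypeR R -> measurableTypeR R).
  by apply: measurable_funD => //; exact: measurable_funM.
pose m' : {measure set (measurableTypeR R) -> \bar R} :=
  mscale (NngNum (normr_ge0 w)) (pushforward_measure lebesgue_measure mg).
have := @lebesgue_measure_unique R m'.
rewrite /m' /= /mscale /= /pushforward_measure /= /pushforward => E; apply/esym/E => //.
move=> _ [[a b] _ <-] /=.
have := w0; rewrite neq_lt => /orP[wlt0|wgt0].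
(* For negative [w] the open and the closed end are exchanged, which does not affect the length. *)
- rewrite (_ : _ @^-1` _ = `[(b - c) / w, (a - c) / w[%classic); last first.
    apply/seteqP; split=> x /=; rewrite !in_itv/=.
      by rewrite ler_ndivrMr// ltr_ndivlMr// [x * w]mulrC ltrBlDr lerBrDr andbC.
    by rewrite ler_ndivrMr// ltr_ndivlMr// [x * w]mulrC ltrBlDr lerBrDr andbC.
  rewrite !lebesgue_measure_itv /= !lte_fin.
  rewrite ltr_ndivlMr// divfK// ltrD2r.
  case: ifPn => ab; last by rewrite mule0.
  rewrite -!EFinB -EFinM; congr _%:E.
  by rewrite ltr0_norm//; field.
- rewrite (_ : _ @^-1` _ = `](a - c) / w, (b - c) / w]%classic); last first.
    apply/seteqP; split=> x /=; rewrite !in_itv/=.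
      by rewrite ltr_pdivrMr// ler_pdivlMr// [x * w]mulrC ltrBlDr lerBrDr.
    by rewrite ltr_pdivrMr// ler_pdivlMr// [x * w]mulrC ltrBlDr lerBrDr.
  rewrite !lebesgue_measure_itv /= !lte_fin.
  rewrite ltr_pdivlMr// divfK// ltrD2r.
  case: ifPn => ab; last by rewrite mule0.
  rewrite -!EFinB -EFinM; congr _%:E.
  by rewrite gtr0_norm//; field.
Qed.

Lemma ge0_integral_affine (R : realType) (w c : R) (f : R -> \bar R) :
  w != 0 -> measurable_fun setT f -> (forall x, 0 <= f x)%E ->
  (`|w|%:E * \int[lebesgue_measure]_x f (w * x + c)%R =
   \int[lebesgue_measure]_x f x)%E.
Proof.
move=> w0 mf f0.
have mg : measurable_fun setT ((fun x => w * x + c) : measurableTypeR R -> measurableTypeR R).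
  by apply: measurable_funD => //; exact: measurable_funM.
pose m' : {measure set (measurableTypeR R) -> \bar R} :=
  mscale (NngNum (normr_ge0 w)) (pushforward_measure lebesgue_measure mg).
transitivity (\int[m']_x f x)%E.
  rewrite ge0_integral_mscale//=; congr (_ * _)%E.
  by rewrite [RHS]ge0_integral_pushforward// => y _; exact: f0.
apply: eq_measure_integral => A mA _.
by rewrite /= /mscale /= -(lebesgue_measure_affine c w0 mA).
Qed.

Lemma normal_probE (R : realType) (m s : R) (A : set R) : measurable A ->
  normal_prob m s A = (\int[lebesgue_measure]_x (\1_A x * normal_pdf m s x)%:E)%E.
Proof.
move=> mA; rewrite /normal_prob integral_mkcond; apply: eq_integral => x _.
by rewrite patchE indicE; case: (x \in A); rewrite ?mul1r ?mul0r.
Qed.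

(* [D] collects what is known of the variables not yet added to the sum [S]. *)
Lemma law_indep_sum (R : realType) d (T : measurableType d) (P : probability T R)
    (D : set T) (S e : T -> R) (c w : R) (g1 g2 : probability (measurableTypeR R) R) :
  measurable D -> measurable_fun setT S -> measurable_fun setT e -> 0 <= c ->
  (forall A B, measurable A -> measurable B ->
    P ([set x | A (S x) /\ B (e x)] `&` D) = (c%:E * (g1 A * g2 B))%E) ->
  forall A, measurable A ->
    P ([set x | A (S x + w * e x)] `&` D) =
    (c%:E * \int[g2]_y g1 [set x | A (x + w * y)%R])%E.
Proof.
move=> mD mS me c0 H A mA.
have mE : measurable_fun setT ((fun z => z.1 + w * z.2) : measurableTypeR R * measurableTypeR R -> R).
  by apply: measurable_funD => //; apply: measurable_funM.
have mSe : measurable_fun setT ((fun x => (S x, e x)) : T -> measurableTypeR R * measurableTypeR R).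
  exact: measurable_fun_pair.
have mAs : measurable [set x | A (S x + w * e x)].
  rewrite -[X in measurable X]setTI.
  by apply: (measurable_funD mS (measurable_funM (measurable_cst w) me)).
have PD : P D = c%:E.
  have -> : D = [set x | [set: measurableTypeR R] (S x) /\ [set: measurableTypeR R] (e x)] `&` D.
    by apply/seteqP; split=> x // [].
  by rewrite H// !probability_setT !mule1.
have [c00|cn0] := eqVneq c 0.
  rewrite c00 mul0e; apply/eqP; rewrite eq_le measure_ge0 andbT.
  apply: (@le_trans _ _ (P D)); last by rewrite PD c00.
  by apply: le_measure; rewrite ?inE//; exact: measurableI.
have cV0 : 0 <= c^-1 by rewrite invr_ge0.
(* Divided by [c], the law of [(S, e)] on [D] is the product of [g1] and [g2]. *)
pose m' := mscale (NngNum cV0) (pushforward_measure (mrestr P mD) mSe).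
have mE' : measurable ((fun z => z.1 + w * z.2) @^-1` A :
    set (measurableTypeR R * measurableTypeR R)).
  by rewrite -[X in measurable X]setTI; exact: mE.
have m'E B C : measurable B -> measurable C -> m' (B `*` C) = (g1 B * g2 C)%E.
  move=> mB mC; rewrite /m' /= /mscale /= /pushforward/= /mrestr/=.
  by rewrite [X in (_ * X)%E](H B C)// muleA -EFinM mulVf// mul1e.
have gE := product_measure_unique m'E mE'.
have gE' := @product_measure_unique _ _ _ _ _ g1 g2 (g1 \x^ g2)%E
  (@product_measure2E _ _ _ _ _ g1 g2) _ mE'.
transitivity (c%:E * (c^-1%:E * P ([set x | A (S x + w * e x)%R] `&` D)))%E.
  by rewrite muleA -EFinM mulfV// mul1e.
congr (_ * _)%E; transitivity ((g1 \x g2)%E ((fun z => z.1 + w * z.2) @^-1` A)).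
  by rewrite gE.
rewrite gE'; apply: eq_integral => y _ /=; congr (g1 _).
by apply/seteqP; split => x; rewrite /ysection/= inE.
Qed.

(** Both sides are the joint density of [y], normal with deviation [b], and [z], normal around
    [w * y] with deviation [a]. The right side is the marginal density of [z] times the conditional
    density of [y] given [z]. *)
Lemma normal_pdf_complete_square (R : realType) (a b w y z : R) :
  a != 0 -> b != 0 ->
  let c := Num.sqrt (a ^+ 2 + w ^+ 2 * b ^+ 2) in
  normal_pdf (w * y) a z * normal_pdf 0 b y =
  normal_pdf 0 c z * normal_pdf (z * w * b ^+ 2 / c ^+ 2) (a * b / c) y.
Proof.
move=> a0 b0 c.
have c2 : c ^+ 2 = a ^+ 2 + w ^+ 2 * b ^+ 2.
  by rewrite sqr_sqrtr// (addr_ge0 (sqr_ge0 _) (mulr_ge0 (sqr_ge0 _) (sqr_ge0 _))).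
have a2 : 0 < a ^+ 2 by rewrite exprn_even_gt0.
have b2 : 0 < b ^+ 2 by rewrite exprn_even_gt0.
have c2_gt0 : 0 < c ^+ 2 by rewrite c2 ltr_pwDl// (mulr_ge0 (sqr_ge0 _) (sqr_ge0 _)).
have c0 : c != 0 by apply: contraTneq c2_gt0 => ->; rewrite expr0n ltxx.
have abc0 : a * b / c != 0 by rewrite !mulf_neq0// invr_eq0.
rewrite !normal_pdfE// mulrACA [RHS]mulrACA; congr (_ * _).
  rewrite /normal_peak -!invfM -!sqrtrM; last 2 first.
  - exact: mulrn_wge0 (mulr_ge0 (sqr_ge0 _) (pi_ge0 _)).
  - exact: mulrn_wge0 (mulr_ge0 (sqr_ge0 _) (pi_ge0 _)).
  congr (Num.sqrt _)^-1.
  by move: c0; clearbody c => c0; field.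
rewrite /normal_fun -!expRD; congr expR.
(* Once [a] is eliminated, no relation is left between the variables and [field] applies. *)
have e : a ^+ 2 = c ^+ 2 - w ^+ 2 * b ^+ 2 by rewrite c2 addrK.
have a2n : c ^+ 2 - w ^+ 2 * b ^+ 2 != 0 by rewrite -e gt_eqF.
rewrite !exprMn exprVn e; move: c0 a2n; clearbody c; clear -b0 => c0 a2n.
by field; rewrite ?c0 ?b0 ?exprMn ?a2n.
Qed.

(** For [v != 0] the left side is a double integral over densities; after Tonelli and completion of
    the square, the conditional density of [y] integrates to 1. *)
Lemma gauss_law_conv (R : realType) (v b w : R) (A : set R) :
  0 <= v -> 0 < b -> measurable A ->
  (\int[normal_prob 0 b]_y gauss_law v [set x | A (x + w * y)%R] =
   gauss_law (v + w ^+ 2 * b ^+ 2) A)%E.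
Proof.
move=> v0 b0 mA; have bn0 : b != 0 by rewrite gt_eqF.
have mAw (y : R) : measurable [set x | A (x + w * y)].
  rewrite -[X in measurable X]setTI.
  by apply: (@measurable_funD _ _ _ _ id (cst (w * y))).
have NT : normal_prob 0 b setT = 1%E by exact: probability_setT.
have mAi : measurable_fun setT (\1_A : R -> R) by exact: measurable_indic.
have bnd (h : R -> \bar R) : (forall y, 0 <= h y <= 1)%E -> measurable_fun setT h ->
    (\int[normal_prob 0 b]_y `|h y| < +oo)%E.
  move=> h01 mh; apply: (@le_lt_trans _ _ (\int[normal_prob 0 b]_y 1)%E).
    apply: ge0_le_integral => //=; first exact: measurableT_comp.
    by move=> y _; have /andP[h0 h1] := h01 y; rewrite gee0_abs.
  by rewrite integral_cst// [X in (_ * X)%E]NT mule1 ltry.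
(* A Dirac mass has no density. Here the claim is the law of [w * y] alone, which is again a Dirac
   mass if [w = 0] and a rescaled normal law otherwise. *)
have [v00|vn0] := eqVneq v 0.
  have dE y : gauss_law v [set x | A (x + w * y)%R] = (\1_A (w * y))%:E.
    rewrite /gauss_law v00 eqxx diracE indicE; congr ((nat_of_bool _)%:R%:E).
    by apply/idP/idP; rewrite !in_setE/= add0r.
  under eq_integral do rewrite dE.
  have [w0|wn0] := eqVneq w 0.
    rewrite v00 w0 expr0n mul0r addr0 {1}/gauss_law eqxx.
    under eq_integral do rewrite mul0r.
    by rewrite integral_cst// [X in (_ * X)%E]NT mule1.
  have mAw' : measurable_fun setT (fun y : R => \1_A (w * y) : R).
    by apply: (measurableT_comp mAi); exact: measurable_funM.
  rewrite integral_normal_prob; last 2 first.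
  - exact/measurable_EFinP.
  - apply: bnd; last exact/measurable_EFinP.
    by move=> y; rewrite !lee_fin indicE; case: (_ \in _); rewrite ?lexx ?ler01.
  rewrite v00 add0r /gauss_law -exprMn sqrf_eq0 mulf_eq0 (negbTE wn0) (negbTE bn0)/=.
  have s0 : `|w| * b != 0 by rewrite mulf_neq0// normr_eq0.
  rewrite sqrtr_sqr normrM (gtr0_norm b0) (normal_probE _ _ mA).
  rewrite -(@ge0_integral_affine _ w 0
    (fun z => (\1_A z * normal_pdf 0 (`|w| * b) z)%:E))//; last 2 first.
  - by apply/measurable_EFinP/measurable_funM => //; exact: measurable_normal_pdf.
  - by move=> x; rewrite lee_fin mulr_ge0// normal_pdf_ge0.
  rewrite -ge0_integralZl_EFin//; last 2 first.
  - by move=> x _; rewrite lee_fin mulr_ge0// normal_pdf_ge0.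
  - apply/measurable_EFinP.
    apply: (measurableT_comp (f := fun z => \1_A z * normal_pdf 0 (`|w| * b) z)).
      by apply/measurable_funM => //; exact: measurable_normal_pdf.
    by apply: measurable_funD => //; exact: measurable_funM.
  apply: eq_integral => y _; rewrite -!EFinM addr0 mulrCA; congr (_ * _)%:E.
  rewrite !normal_pdfE// mulrA /normal_fun/= !subr0; congr (_ * expR _).
    have -> : normal_peak (`|w| * b) = (`|w| * Num.sqrt (b ^+ 2 * pi *+ 2))^-1.
      rewrite /normal_peak exprMn -mulrA -mulrnAr sqrtrM ?sqr_ge0//.
      by rewrite sqrtr_sqr normr_id.
    by rewrite invfM mulrA mulfV ?normr_eq0// mul1r.
  rewrite !exprMn real_normK ?num_real//.
  have /eqP := wn0; move: wn0 bn0; clear => wn0 bn0 _.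
  by field; rewrite wn0 bn0.
have vgt0 : 0 < v by rewrite lt_neqAle eq_sym vn0.
have an0 : Num.sqrt v != 0 by rewrite gt_eqF// sqrtr_gt0.
have cgt0 : 0 < v + w ^+ 2 * b ^+ 2 by rewrite ltr_pwDl// (mulr_ge0 (sqr_ge0 _) (sqr_ge0 _)).
rewrite [RHS]/gauss_law (gt_eqF cgt0).
have mF : measurable_fun setT (fun yz : measurableTypeR R * measurableTypeR R =>
   (\1_A yz.2 * (normal_pdf (w * yz.1) (Num.sqrt v) yz.2))).
  apply: measurable_funM; first exact: measurableT_comp.
  (* The density depends on the pair only through [yz.2 - w * yz.1]. *)
  rewrite (_ : (fun _ => _) = normal_pdf 0 (Num.sqrt v) \o (fun yz => yz.2 - w * yz.1)).
    apply: measurableT_comp; first exact: measurable_normal_pdf.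
    by apply: measurable_funB => //; exact: measurable_funM.
  by apply/funext => yz /=; rewrite !normal_pdfE// /normal_fun subr0.
have lawE y : gauss_law v [set x | A (x + w * y)%R] =
    (\int[lebesgue_measure]_z (\1_A z * normal_pdf (w * y) (Num.sqrt v) z)%:E)%E.
  rewrite /gauss_law (negbTE vn0) (normal_probE _ _ (mAw y)).
  rewrite -[RHS](@ge0_integral_affine _ 1 (w * y))//; last 2 first.
  - by apply/measurable_EFinP/measurable_funM => //; exact: measurable_normal_pdf.
  - by move=> x; rewrite lee_fin mulr_ge0// normal_pdf_ge0.
  rewrite normr1 mul1e; apply: eq_integral => x _; rewrite mul1r !normal_pdfE// /normal_fun.
  rewrite addrK subr0 !indicE; congr (((nat_of_bool _)%:R * _)%:E).
have mlaw : measurable_fun setT (fun y => gauss_law v [set x | A (x + w * y)%R]).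
  under eq_fun do rewrite lawE.
  refine (@measurable_fun_fubini_tonelli_F _ _ _ _ _ lebesgue_measure (fun yz =>
    (\1_A yz.2 * normal_pdf (w * yz.1) (Num.sqrt v) yz.2)%:E) _ _).
  - exact/measurable_EFinP.
  - by move=> x; rewrite lee_fin mulr_ge0// normal_pdf_ge0.
rewrite integral_normal_prob//; last first.
  apply: bnd => // y; rewrite /gauss_law (negbTE vn0).
  apply/andP; split; first exact: measure_ge0.
  exact: (@probability_le1 _ _ R (normal_prob 0 (Num.sqrt v)) _ (mAw y)).
have pdf0 m' s' x : (0 <= (normal_pdf m' s' x : R)%:E)%E by rewrite lee_fin normal_pdf_ge0.
transitivity (\int[lebesgue_measure]_y \int[lebesgue_measure]_z
    (\1_A z * normal_pdf (w * y) (Num.sqrt v) z * normal_pdf 0 b y)%:E)%E.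
  apply: eq_integral => y _; rewrite lawE -ge0_integralZr//.
  - by apply/measurable_EFinP/measurable_funM => //; exact: measurable_normal_pdf.
  - by move=> x _; rewrite lee_fin mulr_ge0// normal_pdf_ge0.
rewrite (@fubini_tonelli _ _ _ _ _ lebesgue_measure lebesgue_measure (fun yz =>
  (\1_A yz.2 * normal_pdf (w * yz.1) (Num.sqrt v) yz.2 * normal_pdf 0 b yz.1)%:E))//=; last 2 first.
- apply/measurable_EFinP/measurable_funM => //.
  by apply: measurableT_comp => //; exact: measurable_normal_pdf.
- by move=> x; rewrite lee_fin !mulr_ge0// normal_pdf_ge0.
rewrite normal_probE//; apply: eq_integral => z _.
under eq_integral do rewrite -mulrA normal_pdf_complete_square// mulrA EFinM.
rewrite (sqr_sqrtr v0) ge0_integralZl_EFin//.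
- by rewrite integral_normal_pdf mule1.
- by apply/measurable_EFinP; exact: measurable_normal_pdf.
- by rewrite mulr_ge0// normal_pdf_ge0.
Qed.

(** [gauss_law] is a bare set function, while [law_indep_sum] takes bundled probabilities. *)
Lemma gauss_law_probability (R : realType) (v : R) :
  exists g : probability (measurableTypeR R) R, forall A, g A = gauss_law v A.
Proof.
rewrite /gauss_law; case: ifP => _; last by exists (normal_prob 0 (Num.sqrt v)).
by exists (\d_(0 : measurableTypeR R)).
Qed.

(** Induction on [s]. The events on the coordinates outside [s] stay in the statement because they
    carry the independence of the next coordinate from the current sum. *)
Lemma iid_normal_partial_sum (R : realType) d (T : measurableType d)
    (P : probability T R) (n : nat) (eps : T -> 'cV[R]_n) (sigma : R)
    (w : 'I_n -> R) (s : seq 'I_n) (A : set R) (B : 'I_n -> set R) :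
  0 < sigma -> iid_normal P eps sigma -> uniq s -> measurable A ->
  (forall i, measurable (B i)) ->
  P ([set x | A (\sum_(i <- s) w i * eps x i 0)] `&`
     [set x | forall i, i \notin s -> B i (eps x i 0)]) =
  (gauss_law (sigma ^+ 2 * \sum_(i <- s) w i ^+ 2) A *
   \prod_(i | i \notin s) normal_prob 0 sigma (B i))%E.
Proof.
move=> s0 [meps iid] us mA mB.
elim: s us A B mA mB => [_|i0 s IH /= /andP[i0s us]] A B mA mB.
  rewrite big_nil mulr0 /gauss_law eqxx diracE.
  transitivity (P ([set x | A 0] `&` [set x | forall i, B i (eps x i 0)])).
    by congr (P (_ `&` _)); apply/seteqP; split => x /=; rewrite ?big_nil// => H i; exact: (H i).
  have [A0|nA0] := pselect (A 0).
    rewrite (mem_set A0) mul1e (eq_bigl xpredT)// -iid//; congr (P _).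
    by apply/seteqP; split => x //= [].
  rewrite (memNset nA0) mul0e -[RHS](measure0 P); congr (P _).
  by apply/seteqP; split => x //= [].
have mS t : measurable_fun setT (fun x => \sum_(i <- t) w i * eps x i 0).
  by apply: measurable_sum => i; exact: measurable_funM.
have mD : measurable [set x | forall i, i \notin i0 :: s -> B i (eps x i 0)].
  rewrite (_ : [set _ | _] = \bigcap_(i in [set i | i \notin i0 :: s]) ((fun x => eps x i 0) @^-1` B i)).
    apply: fin_bigcap_measurable; first exact: finite_finset.
    by move=> i _; rewrite -[X in measurable X]setTI; exact: meps.
  by apply/seteqP; split.
pose c := (\prod_(i | i \notin i0 :: s) normal_prob 0 sigma (B i))%E.
have cfin : c \is a fin_num.
  by apply: prode_fin_num => i _; apply: (@fin_num_measure _ _ _ (normal_prob 0 sigma) _ (mB i)).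
have c0 : (0 <= c)%E by apply: prode_ge0 => i _; exact: measure_ge0.
have [g1 g1E] := gauss_law_probability (sigma ^+ 2 * \sum_(i <- s) w i ^+ 2).
transitivity (P ([set x | A (\sum_(i <- s) w i * eps x i 0 + w i0 * eps x i0 0)]
   `&` [set x | forall i, i \notin i0 :: s -> B i (eps x i 0)])).
  by congr (P (_ `&` _)); apply/seteqP; split => x /=; rewrite big_cons addrC.
rewrite (@law_indep_sum _ _ _ P _ _ (fun x => eps x i0 0) (fine c) (w i0) g1
  (normal_prob 0 sigma) mD (mS s) (meps i0) (fine_ge0 c0) _ _ mA).
  rewrite fineK// muleC; congr (_ * _)%E.
  under eq_integral do rewrite g1E.
  have v0 : 0 <= sigma ^+ 2 * \sum_(i <- s) w i ^+ 2.
    by rewrite mulr_ge0 ?sqr_ge0// sumr_ge0// => i _; exact: sqr_ge0.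
  rewrite (gauss_law_conv (w i0) v0 s0 mA).
  by rewrite big_cons mulrDr addrC [w i0 ^+ 2 * _]mulrC.
move=> A' C mA' mC.
(* The event on the new coordinate [i0] is passed to the induction hypothesis as one of the events
   outside [s]. *)
pose B' i := if i == i0 then C else B i.
have mB' i : measurable (B' i) by rewrite /B'; case: ifP.
transitivity (P ([set x | A' (\sum_(i <- s) w i * eps x i 0)] `&`
     [set x | forall i, i \notin s -> B' i (eps x i 0)])).
  congr (P _); apply/seteqP; split => x /=.
    move=> [[Ax Cx] Bx]; split => // i si; rewrite /B'.
    by case: eqVneq => [->//|ii0]; apply: Bx; rewrite inE negb_or ii0.
  move=> [Ax Bx]; split; first by split => //; have := Bx i0 i0s; rewrite /B' eqxx.
  move=> i; rewrite inE negb_or => /andP[ii0 si].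
  by have := Bx i si; rewrite /B' (negbTE ii0).
rewrite IH// g1E fineK// (bigD1 i0)//= {1}/B' eqxx muleA muleC; congr (_ * _)%E.
apply: eq_big => [i|i /andP[_ /negbTE ii0]]; last by rewrite /B' ii0.
by rewrite inE negb_or andbC.
Qed.

(** A linear form of [M *m eps] is the sum over all indices with weights [u^T *m M], whose squares
    add up to the quadratic form of [M *m M^T] at [u]. *)
Lemma gaussian_vec_mulmx (R : realType) d (T : measurableType d)
    (P : probability T R) (n p : nat) (eps : T -> 'cV[R]_n) (sigma : R)
    (M : 'M[R]_(p, n)) :
  0 < sigma -> iid_normal P eps sigma ->
  gaussian_vec P (fun x => M *m eps x) (sigma ^+ 2 *: (M *m M^T)).
Proof.
move=> s0 iid; have [meps _] := iid; split=> [j|u A mA].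
  under eq_fun do rewrite mxE.
  by apply: measurable_sum => i; exact: measurable_funM.
pose w i := (u^T *m M) 0 i.
have -> : (u^T *m (sigma ^+ 2 *: (M *m M^T)) *m u) 0 0 =
    sigma ^+ 2 * \sum_(i <- enum 'I_n) w i ^+ 2.
  rewrite -scalemxAr -scalemxAl mxE; congr (_ * _).
  rewrite !mulmxA -[_ *m M^T *m u]mulmxA -[M^T *m u]trmxK trmx_mul trmxK mxE big_enum.
  by apply: eq_bigr => i _; rewrite [X in _ * X]mxE.
have := iid_normal_partial_sum w (B := fun=> setT) s0 iid (enum_uniq 'I_n) mA (fun=> measurableT).
rewrite [X in (_ * X)%E]big1 ?mule1; last by move=> i; rewrite mem_enum.
move=> <-; congr (P _); apply/seteqP; split=> x /=.
  by rewrite mulmxA mxE big_enum; split.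
by rewrite mulmxA mxE big_enum => -[].
Qed.

(** * Laws determined by their linear forms *)

(** Only even functions are needed, so real cosines can replace complex exponentials. The bound in
    the limit clause is uniform in [k], as dominated convergence demands. *)
Inductive cos_class (R : realType) : (R -> R) -> Prop :=
| cos_class_cos t : cos_class (fun x => cos (t * x))
| cos_class_lin a f g : cos_class f -> cos_class g ->
    cos_class (fun x => a * f x + g x)
| cos_class_lim (f_ : nat -> R -> R) f M : (forall k, cos_class (f_ k)) ->
    (forall k x, `|f_ k x| <= M) -> (forall x, f_ ^~ x @ \oo --> f x) ->
    cos_class f.

Lemma cvg_norm_le (R : realType) (u : nat -> R) (l M : R) :
  u @ \oo --> l -> (forall k, `|u k| <= M) -> `|l| <= M.
Proof.
move=> ul uM; have nl : (fun k => `|u k|) @ \oo --> `|l| by exact: cvg_norm.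
by apply: (ler_cvg_to nl (@cvg_cst _ M _ _ _)); exact: nearW.
Qed.

Lemma cos_class_bounded (R : realType) (f : R -> R) : cos_class f ->
  measurable_fun setT f /\ exists M, forall x, `|f x| <= M.
Proof.
elim=> [t|a {}f g _ [mf [M fM]] _ [mg [N gN]]|f_ {}f M _ IH fM f_f].
- split; last by exists 1 => x; exact: cos_max.
  apply: (measurableT_comp (f := @cos R)); last exact: measurable_funM.
  by apply: continuous_measurable_fun; exact: continuous_cos.
- split; first by apply: measurable_funD => //; exact: measurable_funM.
  exists (`|a| * M + N) => x; apply: (le_trans (ler_normD _ _)).
  by rewrite lerD// normrM ler_wpM2l.
- split; last by exists M => x; apply: (cvg_norm_le (f_f x)) => k; exact: fM.
  apply: (@measurable_fun_cvg _ _ R setT f_) => [k|x _]; first by have [] := IH k.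
  exact: f_f.
Qed.

Lemma cos_class_ext (R : realType) (f g : R -> R) : f =1 g -> cos_class f -> cos_class g.
Proof. by move=> /funext ->. Qed.

Lemma cos_class_cst (R : realType) (a : R) : cos_class (fun=> a).
Proof.
(* The linear clause scales only its first function, hence the coefficient [a - 1]. *)
apply: (@cos_class_ext _ (fun x => (a - 1) * cos (0 * x) + cos (0 * x))).
  by move=> x; rewrite mul0r cos0; ring.
by apply: cos_class_lin; exact: cos_class_cos.
Qed.

(** Closure under products takes two inductions. In this one the first factor is a cosine, and the
    base case is the product-to-sum formula. *)
Lemma cos_class_cosM (R : realType) (s : R) (g : R -> R) :
  cos_class g -> cos_class (fun x => cos (s * x) * g x).
Proof.
elim=> [t|a {}f {}g _ cf _ cg|f_ {}f M _ IH fM f_f].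
- apply: (@cos_class_ext _ (fun x => 2^-1 * cos ((s + t) * x) +
    (2^-1 * cos ((s - t) * x) + 0))).
    by move=> x; rewrite mulrDl mulrBl cosD cosB; field.
  apply: cos_class_lin; first exact: cos_class_cos.
  by apply: cos_class_lin; [exact: cos_class_cos|exact: cos_class_cst].
- apply: (@cos_class_ext _ (fun x => a * (cos (s * x) * f x) + cos (s * x) * g x)).
    by move=> x; ring.
  exact: cos_class_lin.
- apply: (cos_class_lim (M := M) IH) => [k x|x].
    by rewrite normrM -[leRHS]mul1r ler_pM// cos_max.
  by apply: cvgM; [exact: cvg_cst|exact: f_f].
Qed.

(** The second induction, on the other factor; a bound on [g] keeps the products uniformly bounded
    in the limit clause. *)
Lemma cos_classM (R : realType) (f g : R -> R) :
  cos_class f -> cos_class g -> cos_class (fun x => f x * g x).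
Proof.
move=> cf cg; have [_ [N gN]] := cos_class_bounded cg.
elim: cf => [t|a {}f h _ IHf _ IHh|f_ {}f M _ IH fM f_f].
- exact: cos_class_cosM.
- apply: (@cos_class_ext _ (fun x => a * (f x * g x) + h x * g x)).
    by move=> x; ring.
  exact: cos_class_lin.
- apply: (cos_class_lim (M := M * N) IH) => [k x|x].
    by rewrite normrM ler_pM.
  by apply: cvgM; [exact: f_f|exact: cvg_cst].
Qed.

Lemma cos_classX (R : realType) (f : R -> R) n :
  cos_class f -> cos_class (fun x => f x ^+ n).
Proof.
move=> cf; elim: n => [|n IH]; first exact: cos_class_cst.
by under eq_fun do rewrite exprS; exact: cos_classM.
Qed.

Lemma cos_class_onem (R : realType) (f : R -> R) :
  cos_class f -> cos_class (fun x => 1 - f x).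
Proof.
move=> cf; apply: (@cos_class_ext _ (fun x => -1 * f x + 1)).
  by move=> x; ring.
by apply: cos_class_lin => //; exact: cos_class_cst.
Qed.

(** * Polynomial approximation of a threshold *)

Lemma bernoulli_inequality (R : realType) (x : R) n : 0 <= x <= 1 ->
  1 - n%:R * x <= (1 - x) ^+ n.
Proof.
move=> /andP[x0 x1]; elim: n => [|n IH]; first by rewrite mul0r subr0 expr0.
have h : (1 - x) * (1 - n%:R * x) <= (1 - x) ^+ n.+1.
  by rewrite exprS ler_wpM2l// subr_ge0.
apply: le_trans h; rewrite -subr_ge0.
have -> : (1 - x) * (1 - n%:R * x) - (1 - n.+1%:R * x) = n%:R * x ^+ 2.
  by rewrite -natr1; ring.
by rewrite mulr_ge0// sqr_ge0.
Qed.

(** The product is at most [(1 - x) ^+ n * (1 + x) ^+ n = (1 - x ^+ 2) ^+ n]. *)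
Lemma onem_expr_le (R : realType) (x : R) n : 0 <= x <= 1 ->
  (1 - x) ^+ n * (1 + n%:R * x) <= 1.
Proof.
move=> /andP[x0 x1].
have b : 1 + n%:R * x <= (1 + x) ^+ n.
  elim: n => [|n IH]; first by rewrite mul0r addr0 expr0.
  have h : (1 + x) * (1 + n%:R * x) <= (1 + x) ^+ n.+1.
    by rewrite exprS ler_wpM2l// addr_ge0.
  apply: le_trans h; rewrite -subr_ge0.
  have -> : (1 + x) * (1 + n%:R * x) - (1 + n.+1%:R * x) = n%:R * x ^+ 2.
    by rewrite -natr1; ring.
  by rewrite mulr_ge0// sqr_ge0.
have h0 : 0 <= (1 - x) ^+ n by rewrite exprn_ge0// subr_ge0.
apply: (le_trans (ler_wpM2l h0 b)); rewrite -exprMn -[leRHS](expr1n _ n).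
have := sqr_ge0 x => x2.
by rewrite lerXn2r// ?nnegrE ?mulr_ge0 ?subr_ge0 ?addr_ge0//; nra.
Qed.

(** The right side is [1 - s] times the sum of the [s ^+ i] for [i < k], and each of these [k] terms
    is at least [s ^+ k]. *)
Lemma natr_expr_le (R : realType) (s : R) k : 0 <= s < 1 ->
  k%:R * s ^+ k * (1 - s) <= 1 - s ^+ k.
Proof.
move=> /andP[s0 s1]; elim: k => [|k IH]; first by rewrite !mul0r expr0 subrr.
have h1 : s * (k%:R * s ^+ k * (1 - s)) <= s * (1 - s ^+ k) by rewrite ler_wpM2l.
have h2 : 0 <= (1 - s) * (1 - s ^+ k.+1).
  by apply: mulr_ge0; rewrite subr_ge0; [exact: ltW|apply: exprn_ile1 => //; exact: ltW].
rewrite -natr1; move: h1 h2; rewrite exprS; set e := s ^+ k; nra.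
Qed.

(** With [s] the square root of [r], one factor [s ^+ k] keeps [k.+2%:R * s ^+ k] below
    [(1 - s)^-1 + 2] and the other tends to 0. *)
Lemma cvg_natr_expr (R : realType) (r : R) : 0 <= r < 1 ->
  (fun k => (k.+2)%:R * r ^+ k) @ \oo --> (0 : R).
Proof.
move=> /andP[r0 r1]; pose s := Num.sqrt r.
have s0 : 0 <= s by exact: sqrtr_ge0.
have s1 : s < 1 by rewrite -sqrtr1 ltr_sqrt.
have rE : r = s * s by rewrite -expr2 sqr_sqrtr.
have s01 : 0 < 1 - s by rewrite subr_gt0.
apply: (@squeeze_cvgr _ _ _ _ (fun=> 0) (geometric ((1 - s)^-1 + 2) s)).
- near=> k; rewrite mulr_ge0 ?exprn_ge0//= rE exprMn mulrA ler_wpM2r ?exprn_ge0//.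
  have h : k%:R * s ^+ k <= (1 - s)^-1.
    rewrite -[leRHS]mul1r ler_pdivlMr//.
    by apply: le_trans (natr_expr_le _ _) _; rewrite ?s0// gerBl exprn_ge0.
  rewrite -addn2 natrD mulrDl lerD// ler_piMr//.
  by apply: exprn_ile1 => //; exact: ltW.
- exact: cvg_cst.
- by apply: cvg_geometric; rewrite ger0_norm.
Unshelve. all: by end_near. Qed.

(* With [L] of order [(k + 1) / q ^ k], [L * y ^ k] tends to [0] if [y < q] and to
   infinity if [q <= y], so [1 - (1 - y ^ k) ^ L] tends to the indicator of [q <= y]. *)
Definition threshold_exponent (R : realType) (q : R) (k : nat) : nat :=
  (Num.truncn (k.+1%:R / q ^+ k)).+1.

Lemma cvg_threshold (R : realType) (q y : R) : 0 < q <= 1 -> 0 <= y <= 1 ->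
  (fun k => 1 - (1 - y ^+ k) ^+ threshold_exponent q k) @ \oo --> ((q <= y)%R%:R : R).
Proof.
move=> /andP[q0 q1] /andP[y0 y1].
pose L k : R := (threshold_exponent q k)%:R.
have Lgt k : k.+1%:R / q ^+ k < L k by exact: truncnS_gt.
have Lle k : L k <= k.+1%:R / q ^+ k + 1.
  by rewrite /L /threshold_exponent -natr1 lerD2r truncn_le divr_ge0// exprn_ge0// ltW.
have yk k : 0 <= y ^+ k <= 1 by rewrite exprn_ge0// exprn_ile1.
have pw_le1 k : (1 - y ^+ k) ^+ threshold_exponent q k <= 1.
  have /andP[a b] := yk k.
  by rewrite exprn_ile1// ?subr_ge0// gerBl.
have pw_ge0 k : 0 <= (1 - y ^+ k) ^+ threshold_exponent q k.
  by have /andP[a b] := yk k; rewrite exprn_ge0// subr_ge0.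
have [qy|yq] := leP q y.
  rewrite -[X in _ --> X]subr0; apply: cvgB; first exact: cvg_cst.
  (* By [onem_expr_le] the power is at most the inverse of [1 + L k * y ^+ k], and [L k * y ^+ k] is
     at least [L k * q ^+ k], hence at least [k.+1]. *)
  apply: (@squeeze_cvgr _ _ _ _ (fun=> 0) harmonic); last 2 first.
  - exact: cvg_cst.
  - exact: cvg_harmonic.
  near=> k; rewrite pw_ge0/= /harmonic -[leRHS]mul1r ler_pdivlMr ?ltr0n//.
  apply: le_trans (onem_expr_le (threshold_exponent q k) (yk k)).
  rewrite ler_wpM2l ?pw_ge0//; apply: (@le_trans _ _ (L k * y ^+ k)); last by rewrite lerDr.
  apply: (@le_trans _ _ (L k * q ^+ k)).
    by rewrite -ler_pdivrMr ?exprn_gt0// ltW.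
  by rewrite ler_wpM2l ?ler0n// lerXn2r// nnegrE ltW.
have r01 : 0 <= y / q < 1.
  by apply/andP; split; [apply: divr_ge0 => //; exact: ltW|rewrite ltr_pdivrMr// mul1r].
(* Bernoulli bounds the difference by [L k * y ^+ k]. The rounding in [L k] adds at most [y ^+ k],
   itself at most [(y / q) ^+ k], which turns [k.+1] into [k.+2]. *)
apply: (@squeeze_cvgr _ _ _ _ (fun=> 0) (fun k => k.+2%:R * (y / q) ^+ k)); last 2 first.
- exact: cvg_cst.
- exact: cvg_natr_expr.
near=> k; rewrite subr_ge0 pw_le1/= lerBlDr -lerBlDl.
apply: (le_trans _ (bernoulli_inequality (threshold_exponent q k) (yk k))).
rewrite lerD2l lerN2; have /andP[yk0 yk1] := yk k.
apply: (le_trans (ler_wpM2r yk0 (Lle k))).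
have z1 : 1 <= (q ^+ k)^-1.
  by rewrite invf_ge1 ?exprn_gt0//; apply: exprn_ile1 => //; exact: ltW.
rewrite expr_div_n -[k.+2%:R]natr1 -subr_ge0.
rewrite (_ : _ - _ = y ^+ k * ((q ^+ k)^-1 - 1)); last by ring.
by rewrite mulr_ge0// subr_ge0.
Unshelve. all: by end_near. Qed.

(** The approximants of [cvg_threshold] are polynomials in [f] with values in the unit interval. *)
Lemma cos_class_threshold (R : realType) (f : R -> R) (q : R) :
  cos_class f -> (forall x, 0 <= f x <= 1) -> 0 < q <= 1 ->
  cos_class (fun x => (q <= f x)%R%:R).
Proof.
move=> cf f01 q01.
apply: (@cos_class_lim _ (fun k x => 1 - (1 - f x ^+ k) ^+ threshold_exponent q k) _ 1).
- by move=> k; apply/cos_class_onem/cos_classX/cos_class_onem/cos_classX.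
- move=> k x; have /andP[a b] := f01 x.
  have c : 0 <= 1 - f x ^+ k by rewrite subr_ge0 exprn_ile1.
  rewrite ger0_norm ?gerBl ?exprn_ge0// subr_ge0 exprn_ile1// gerBl exprn_ge0//.
- by move=> x; exact: cvg_threshold.
Qed.

(** * Indicators of symmetric sets in the cosine class *)

Lemma ler_cos (R : realType) (x y : R) : 0 <= x <= pi -> 0 <= y <= pi ->
  (cos x <= cos y) = (y <= x).
Proof.
by move=> x0 y0; rewrite !leNgt ltr_cos// in_itv.
Qed.

Lemma cos_class_norm_le (R : realType) (c : R) :
  cos_class (fun x => (`|x| <= c)%R%:R).
Proof.
have [c0|c0] := ltP c 0.
  apply: (cos_class_ext _ (cos_class_cst 0)) => x.
  by rewrite leNgt (lt_le_trans c0).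
(* [M k] tends to infinity and exceeds [c], so [c / M k] is below 1 and hence in the range where the
   cosine decreases. *)
pose M k : R := k.+1%:R + c.
have M0 k : 0 < M k by rewrite ltr_wpDr// ltr0n.
have pi1 : 1 <= pi :> R by rewrite (le_trans _ (pi_ge2 _))// ler1n.
have cM k : 0 <= c / M k < 1.
  by rewrite divr_ge0 ?(ltW (M0 k))//= ltr_pdivrMr// mul1r /M ltrDr ltr0n.
(* A set [cos (x / M) >= cos (c / M)] is periodic, and agrees with [-c, c] near [x]
   as soon as [|x| < M]. *)
apply: (@cos_class_lim _ (fun k x => (2^-1 * (1 + cos (c / M k)) <=
    2^-1 * (1 + cos ((M k)^-1 * x)))%R%:R) _ 1).
(* Half of 1 plus a cosine lies in the unit interval; the threshold is positive because [c / M k] is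
   less than [pi]. *)
- move=> k; apply: cos_class_threshold.
  + apply: (@cos_class_ext _ (fun x => 2^-1 * cos ((M k)^-1 * x) + 2^-1)).
      by move=> x; ring.
    by apply: cos_class_lin; [exact: cos_class_cos|exact: cos_class_cst].
  + by move=> x; have := cos_geN1 ((M k)^-1 * x); have := cos_le1 ((M k)^-1 * x); lra.
  + have /andP[cM0 cM1] := cM k.
    have : cos pi < cos (c / M k).
      rewrite ltr_cos ?in_itv/= ?pi_ge0 ?lexx ?cM0 ?(ltW (lt_le_trans cM1 pi1))//.
      exact: lt_le_trans pi1.
    by rewrite cospi; have := cos_le1 (c / M k); lra.
- by move=> k x; rewrite normr_nat lern1 leq_b1.
- move=> x; apply: cvg_near_cst; near=> k; congr ((nat_of_bool _)%:R).
  have xM : `|x| < M k.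
    have : `|x| < k%:R by near: k; exact: nbhs_infty_gtr.
    by move/lt_le_trans; apply; rewrite /M -natr1 -addrA lerDl addr_ge0.
  rewrite ler_pM2l// lerD2l -[cos (_ * x)]cos_norm normrM gtr0_norm ?invr_gt0//.
  rewrite [_ * `|x|]mulrC ler_cos.
  + by rewrite ler_pM2r// invr_gt0.
  + by have /andP[-> /ltW cM1] := cM k; exact: le_trans pi1.
  + apply/andP; split; first by apply: divr_ge0 => //; exact: ltW.
    by apply: le_trans pi1; rewrite ler_pdivrMr// mul1r ltW.
Unshelve. all: by end_near. Qed.

(** Such a set is the whole line, a closed half-line or an open one. In each case closed half-lines
    with end points in the set increase to it. *)
Lemma down_closed_half_lines (R : realType) (D : set R) : D !=set0 ->
  (forall x y, y <= x -> D x -> D y) ->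
  exists c : nat -> R, [/\ {homo c : m n / (m <= n)%N >-> m <= n},
    forall k, D (c k) & forall x, D x -> exists k, x <= c k].
Proof.
move=> D0 Ddown.
have [ubD|nubD] := pselect (has_ubound D); last first.
  exists (fun k => k%:R); split; first by move=> m n; rewrite ler_nat.
  - move=> k; apply: contrapT => nD; apply: nubD; exists k%:R => x Dx.
    by rewrite leNgt; apply/negP => /ltW/Ddown; auto.
  - by move=> x _; exists (Num.truncn x).+1; rewrite ltW// truncnS_gt.
have hsD : has_sup D by [].
have [Ds|nDs] := pselect (D (sup D)).
  exists (fun=> sup D); split => // x Dx; exists 0%N.
  exact: ub_le_sup.
exists (fun k => sup D - k.+1%:R^-1); split.
- by move=> m n mn; rewrite lerD2l lerN2 lef_pV2 ?posrE ?ltr0n// ler_nat.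
- move=> k; have e0 : 0 < k.+1%:R^-1 :> R by rewrite invr_gt0 ltr0n.
  have [e De /ltW] := sup_adherent e0 hsD.
  by move/Ddown; apply.
- move=> x Dx; have xs : x < sup D.
    rewrite lt_neqAle (ub_le_sup ubD Dx) andbT.
    by apply: contra_notN nDs => /eqP <-.
  have sx : 0 < sup D - x by rewrite subr_gt0.
  (* This [k] satisfies [(sup D - x)^-1 < k.+1]. *)
  exists (Num.truncn (sup D - x)^-1).
  rewrite lerBrDr addrC -lerBrDr -[leRHS]invrK lef_pV2 ?posrE ?ltr0n ?invr_gt0//.
  by rewrite ltW// truncnS_gt.
Qed.

(** Stated for down-closed sets because monotonicity of [Phi] gives the acceptance regions of the
    p-values exactly this shape. The indicators of the approximating half-lines are eventually
    constant at each point. *)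
Lemma cos_class_norm_down_closed (R : realType) (D : set R) :
  (forall x y, y <= x -> D x -> D y) ->
  cos_class (fun x => (\1_D `|x| : R)).
Proof.
move=> Ddown.
have [D0|/set0P/negP/negPn/eqP ->] := pselect (D !=set0); last first.
  by apply: (cos_class_ext _ (cos_class_cst 0)) => x; rewrite indicE in_set0.
have [c [cmono Dc cD]] := down_closed_half_lines D0 Ddown.
apply: (@cos_class_lim _ (fun k x => (`|x| <= c k)%R%:R) _ 1).
- by move=> k; exact: cos_class_norm_le.
- by move=> k x; rewrite normr_nat lern1 leq_b1.
- move=> x; apply: cvg_near_cst; rewrite indicE.
  have [Dx|nDx] := pselect (D `|x|).
    have [k0 xk0] := cD _ Dx; near=> k; rewrite mem_set//.
    by rewrite (le_trans xk0)//; apply: cmono; near: k; exact: nbhs_infty_ge.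
  apply: nearW => k; rewrite memNset//; case: (leP `|x| (c k)) => // xc.
  by exfalso; apply: nDx; exact: Ddown (Dc k).
Unshelve. all: by end_near. Qed.

(** * From linear forms to joint events *)

Lemma probability_integrable_bounded (R : realType) d (T : measurableType d)
    (P : probability T R) (f : T -> R) (M : R) :
  measurable_fun setT f -> (forall x, `|f x| <= M) ->
  P.-integrable setT (EFin \o f).
Proof.
move=> mf fM; apply: measurable_bounded_integrable => //.
  exact: le_lt_trans (probability_le1 P measurableT) (ltry 1).
exists M; split; first exact: num_real.
by move=> K MK x _; exact: le_trans (fM x) (ltW MK).
Qed.

(** Replaces one cosine factor by any function of the class, [g] and [g'] standing for the remaining
    factors. Linearity and dominated convergence handle the two closure clauses. *)
Lemma cos_class_integral_eq (R : realType) d d' (T : measurableType d)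
    (T' : measurableType d') (P : probability T R) (Q : probability T' R)
    (X g : T -> R) (X' g' : T' -> R) (M : R) (f : R -> R) :
  measurable_fun setT X -> measurable_fun setT X' ->
  measurable_fun setT g -> measurable_fun setT g' ->
  (forall x, `|g x| <= M) -> (forall x, `|g' x| <= M) ->
  (forall t, \int[P]_x (cos (t * X x) * g x)%:E = \int[Q]_x (cos (t * X' x) * g' x)%:E)%E ->
  cos_class f ->
  (\int[P]_x (f (X x) * g x)%:E = \int[Q]_x (f (X' x) * g' x)%:E)%E.
Proof.
move=> mX mX' mg mg' gM g'M E.
have int d0 (T0 : measurableType d0) (P0 : probability T0 R) (X0 g0 : T0 -> R) f0 :
    measurable_fun setT X0 -> measurable_fun setT g0 -> (forall x, `|g0 x| <= M) ->
    cos_class f0 -> P0.-integrable setT (fun x => (f0 (X0 x) * g0 x)%:E).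
  move=> mX0 mg0 g0M cf0; have [mf0 [N f0N]] := cos_class_bounded cf0.
  apply: (@probability_integrable_bounded _ _ _ _ _ (N * M)).
    by apply: measurable_funM => //; exact: measurableT_comp.
  by move=> x; rewrite normrM ler_pM.
elim=> [t|a {}f h cf IHf ch IHh|f_ {}f N cf_ IH fN f_f]; first exact: E.
- have lin d0 (T0 : measurableType d0) (P0 : probability T0 R) (X0 g0 : T0 -> R) :
      measurable_fun setT X0 -> measurable_fun setT g0 -> (forall x, `|g0 x| <= M) ->
      (\int[P0]_x ((a * f (X0 x) + h (X0 x)) * g0 x)%:E =
       a%:E * \int[P0]_x (f (X0 x) * g0 x)%:E + \int[P0]_x (h (X0 x) * g0 x)%:E)%E.
    move=> mX0 mg0 g0M; rewrite -integralZl//; last exact: int.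
    rewrite -integralD//; last 2 first.
    - by apply: integrableZl => //; exact: int.
    - exact: int.
    by apply: eq_integral => x _; rewrite -EFinM -EFinD mulrDl mulrA.
  by rewrite !lin// IHf IHh.
- have lim d0 (T0 : measurableType d0) (P0 : probability T0 R) (X0 g0 : T0 -> R) :
      measurable_fun setT X0 -> measurable_fun setT g0 -> (forall x, `|g0 x| <= M) ->
      ((\int[P0]_x (f_ k (X0 x) * g0 x)%:E)%E @[k --> \oo] -->
       (\int[P0]_x (f (X0 x) * g0 x)%:E)%E).
    move=> mX0 mg0 g0M.
    apply: (@dominated_cvg _ _ _ P0 _ _ _ _ (cst (N * M)%:E)) => //.
    - move=> k; exact: (measurable_int P0 (int _ _ P0 _ _ _ mX0 mg0 g0M (cf_ k))).
    - move=> x _; apply: cvg_EFin; first by near=> k.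
      by apply: cvgM; [exact: f_f|exact: cvg_cst].
    - apply: (@probability_integrable_bounded _ _ _ _ _ `|N * M|) => //.
    - by move=> k x _; rewrite /= lee_fin normrM ler_pM.
  have := lim _ _ P X g mX mg gM; under eq_fun do rewrite IH.
  by move=> lP; exact: cvg_unique lP (lim _ _ Q X' g' mX' mg' g'M).
Unshelve. all: by end_near. Qed.

(** The factors are introduced one by one, next to the cosine of an arbitrary linear form. That
    cosine absorbs the one from the new coordinate, so the induction hypothesis must hold for every
    [u]. *)
Lemma cramer_wold_cos_class (R : realType) d d' (T : measurableType d)
    (T' : measurableType d') (P : probability T R) (Q : probability T' R) (p : nat)
    (Z : T -> 'cV[R]_p) (Z' : T' -> 'cV[R]_p) (f_ : 'I_p -> R -> R) :
  (forall j, measurable_fun setT (fun x => Z x j 0)) ->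
  (forall j, measurable_fun setT (fun x => Z' x j 0)) ->
  (forall (u : 'cV[R]_p) (A : set R), measurable A ->
    P [set x | A ((u^T *m Z x) 0 0)] = Q [set x | A ((u^T *m Z' x) 0 0)]) ->
  (forall j, cos_class (f_ j)) ->
  (\int[P]_x (\prod_j f_ j (Z x j 0))%:E = \int[Q]_x (\prod_j f_ j (Z' x j 0))%:E)%E.
Proof.
move=> mZ mZ' PQ cf.
have mlin d0 (T0 : measurableType d0) (Z0 : T0 -> 'cV[R]_p) (u : 'cV[R]_p) :
    (forall j, measurable_fun setT (fun x => Z0 x j 0)) ->
    measurable_fun setT (fun x => (u^T *m Z0 x) 0 0).
  move=> mZ0; under eq_fun do rewrite mxE.
  by apply: measurable_sum => i; exact: measurable_funM.
have mcos : measurable_fun setT (@cos R).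
  by apply: continuous_measurable_fun; exact: continuous_cos.
have [M fM] := choice (fun j => (cos_class_bounded (cf j)).2).
have mf j : measurable_fun setT (f_ j) by have [] := cos_class_bounded (cf j).
have mprod d0 (T0 : measurableType d0) (Z0 : T0 -> 'cV[R]_p) (u : 'cV[R]_p) s :
    (forall j, measurable_fun setT (fun x => Z0 x j 0)) ->
    measurable_fun setT (fun x => cos ((u^T *m Z0 x) 0 0) * \prod_(j <- s) f_ j (Z0 x j 0)).
  move=> mZ0; apply: measurable_funM; first exact: measurableT_comp (mlin _ _ _ _ mZ0).
  by apply: measurable_prod => j _; exact: measurableT_comp.
have bprod d0 (T0 : measurableType d0) (Z0 : T0 -> 'cV[R]_p) (u : 'cV[R]_p) s x :
    `|cos ((u^T *m Z0 x) 0 0) * \prod_(j <- s) f_ j (Z0 x j 0)| <= \prod_(j <- s) M j.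
  rewrite normrM -[leRHS]mul1r ler_pM ?cos_max// normr_prod.
  by apply: ler_prod => j _; rewrite normr_ge0 fM.
have key s : forall u : 'cV[R]_p,
  (\int[P]_x (cos ((u^T *m Z x) 0 0) * \prod_(j <- s) f_ j (Z x j 0))%:E =
   \int[Q]_x (cos ((u^T *m Z' x) 0 0) * \prod_(j <- s) f_ j (Z' x j 0))%:E)%E.
  elim: s => [|j s IH] u.
    (* Without factors, the integral is that of the cosine under the law of a single linear form. *)
    have law d0 (T0 : measurableType d0) (P0 : probability T0 R) (Z0 : T0 -> 'cV[R]_p)
        (mZ0 : forall j, measurable_fun setT (fun x => Z0 x j 0)) :
      (\int[P0]_x (cos ((u^T *m Z0 x) 0 0) * \prod_(j <- [::]) f_ j (Z0 x j 0))%:E =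
       \int[pushforward_measure P0 (mlin _ _ _ u mZ0)]_y (cos y)%:E)%E.
      rewrite [RHS](integral_pushforward (mlin _ _ _ u mZ0))//; last 2 first.
      - exact/measurable_EFinP.
      - apply: (@probability_integrable_bounded _ _ _ P0 _ 1); last by move=> x; exact: cos_max.
        exact: measurableT_comp (mlin _ _ _ _ mZ0).
      by apply: eq_integral => x _; rewrite big_nil mulr1.
    rewrite (law _ _ _ _ mZ) (law _ _ _ _ mZ').
    by apply: eq_measure_integral => A mA _; exact: PQ.
  have shuffle d0 (T0 : measurableType d0) (P0 : probability T0 R) (Z0 : T0 -> 'cV[R]_p) :
     (\int[P0]_x (cos ((u^T *m Z0 x) 0 0) * \prod_(j <- j :: s) f_ j (Z0 x j 0))%:E =
      \int[P0]_x (f_ j (Z0 x j 0) * (cos ((u^T *m Z0 x) 0 0) * \prod_(j <- s) f_ j (Z0 x j 0)))%:E)%E.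
    by apply: eq_integral => x _; rewrite big_cons mulrCA.
  rewrite !shuffle; apply: cos_class_integral_eq (bprod _ _ Z u s) (bprod _ _ Z' u s) _ (cf j) => //.
  - exact: mprod.
  - exact: mprod.
  move=> t.
  (* Product-to-sum: the two cosines become those of the linear forms with coefficients [u] shifted
     by [t] up or down in coordinate [j]. *)
  have split d0 (T0 : measurableType d0) (P0 : probability T0 R) (Z0 : T0 -> 'cV[R]_p) :
    (forall j, measurable_fun setT (fun x => Z0 x j 0)) ->
    (\int[P0]_x (cos (t * Z0 x j 0) * (cos ((u^T *m Z0 x) 0 0) * \prod_(j <- s) f_ j (Z0 x j 0)))%:E =
     2^-1%:E * \int[P0]_x (cos (((u + t *: delta_mx j 0)^T *m Z0 x) 0 0) *
       \prod_(j <- s) f_ j (Z0 x j 0))%:E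
   + 2^-1%:E * \int[P0]_x (cos (((u - t *: delta_mx j 0)^T *m Z0 x) 0 0) *
       \prod_(j <- s) f_ j (Z0 x j 0))%:E)%E.
    move=> mZ0.
    have int (v : 'cV[R]_p) : P0.-integrable setT
        (fun x => (cos ((v^T *m Z0 x) 0 0) * \prod_(j <- s) f_ j (Z0 x j 0))%:E).
      exact: (@probability_integrable_bounded _ _ _ P0 _ _ (mprod _ _ _ v s mZ0) (bprod _ _ Z0 v s)).
    rewrite -!integralZl// -integralD//; [|exact: integrableZl..].
    apply: eq_integral => x _; rewrite -!EFinM -EFinD; congr _%:E.
    have e : ((t *: delta_mx j 0 : 'cV[R]_p)^T *m Z0 x) 0 0 = t * Z0 x j 0.
      have -> : (t *: delta_mx j 0)^T = t *: delta_mx 0 j :> 'rV[R]_p.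
        by apply/matrixP => a b; rewrite !mxE andbC.
      by rewrite -scalemxAl mxE -rowE mxE.
    have eD (v : 'cV[R]_p) : (u + v)^T = u^T + v^T by apply/matrixP => a b; rewrite !mxE.
    have eN (v : 'cV[R]_p) : (- v)^T = - v^T by apply/matrixP => a b; rewrite !mxE.
    have eM (a b : 'M[R]_1) : (a + b) 0 0 = a 0 0 + b 0 0 by rewrite mxE.
    have eO (a : 'M[R]_1) : (- a) 0 0 = - a 0 0 by rewrite mxE.
    rewrite !eD eN !mulmxDl mulNmx !eM eO e cosD cosB.
    set c := cos _; set s1 := sin _; set k := cos _; set s2 := sin _.
    by field.
  by rewrite !split// !IH.
(* For [u = 0] the cosine factor is 1. *)
have := key (index_enum 'I_p) 0.
under eq_integral do rewrite trmx0 mul0mx mxE cos0 mul1r.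
by under [in X in _ = X -> _]eq_integral do rewrite trmx0 mul0mx mxE cos0 mul1r.
Qed.

Lemma down_closed_measurable (R : realType) (D : set R) :
  (forall x y, y <= x -> D x -> D y) -> measurable D.
Proof.
move=> Dd; apply: is_interval_measurable => x y Dx Dy z /andP[_ zy].
exact: Dd Dy.
Qed.

Lemma measurable_norm_exceed (R : realType) d (T : measurableType d) (p : nat)
    (Z : T -> 'cV[R]_p) (U : 'I_p -> set R) :
  (forall j, measurable_fun setT (fun x => Z x j 0)) ->
  (forall j x y, x <= y -> U j x -> U j y) ->
  measurable [set z | exists j, U j `|Z z j 0|].
Proof.
move=> mZ Uup; rewrite (_ : [set _ | _] =
    \bigcup_(j in [set: 'I_p]) ((fun z => `|Z z j 0|) @^-1` U j)); last first.
  by apply/seteqP; split => z /=; [move=> [j Uj]; exists j|move=> [j _ Uj]; exists j].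
apply: fin_bigcup_measurable => [|j _]; first exact: finite_finset.
have mU : measurable (U j).
  rewrite -[U j]setCK; apply: measurableC; apply: down_closed_measurable => x y yx nUx Uy.
  by apply: nUx; exact: Uup Uy.
rewrite -[X in measurable X]setTI.
by apply: (measurableT_comp (f := fun y : R => `|y|) _ (mZ j)).
Qed.

(** The indicator of the complement is a product over [j] of indicators of down-closed sets
    evaluated at the absolute values. *)
Lemma cramer_wold_exceed (R : realType) d d' (T : measurableType d)
    (T' : measurableType d') (P : probability T R) (Q : probability T' R) (p : nat)
    (Z : T -> 'cV[R]_p) (Z' : T' -> 'cV[R]_p) (C : 'M[R]_p) (U : 'I_p -> set R) :
  gaussian_vec P Z C -> gaussian_vec Q Z' C ->
  (forall j x y, x <= y -> U j x -> U j y) ->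
  P [set z | exists j, U j `|Z z j 0|] = Q [set z | exists j, U j `|Z' z j 0|].
Proof.
move=> [mZ lZ] [mZ' lZ'] Uup.
have law (u : 'cV[R]_p) (A : set R) : measurable A ->
    P [set x | A ((u^T *m Z x) 0 0)] = Q [set x | A ((u^T *m Z' x) 0 0)].
  by move=> mA; rewrite lZ// lZ'.
have cc j : cos_class (fun x => \1_(~` U j) `|x| : R).
  by apply: cos_class_norm_down_closed => x y yx nUx Uy; apply: nUx; exact: Uup Uy.
have int d0 (T0 : measurableType d0) (P0 : probability T0 R) (Z0 : T0 -> 'cV[R]_p) :
    (forall j, measurable_fun setT (fun x => Z0 x j 0)) ->
    (\int[P0]_x (\prod_j (\1_(~` U j) `|Z0 x j 0| : R))%:E)%E =
    P0 (~` [set z | exists j, U j `|Z0 z j 0|]).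
  move=> mZ0; rewrite -[X in _ = P0 X]setIT -integral_indic//; last first.
    by apply: measurableC; exact: measurable_norm_exceed.
  apply: eq_integral => x _; congr _%:E; rewrite indicE.
  have [Ux|nUx] := pselect (exists j, U j `|Z0 x j 0|).
    rewrite memNset; last by move/(_ Ux).
    by case: Ux => j Uj; rewrite (bigD1 j)//= indicE memNset ?mul0r// => /(_ Uj).
  rewrite mem_set// big1// => j _; rewrite indicE mem_set// => Uj.
  by apply: nUx; exists j.
have := cramer_wold_cos_class mZ mZ' law cc; rewrite !int//.
rewrite !probability_setC; last 2 first.
- exact: measurable_norm_exceed.
- exact: measurable_norm_exceed.
move=> E.
have m1 := measurable_norm_exceed mZ Uup; have m2 := measurable_norm_exceed mZ' Uup.
have f1 := fin_num_measure P _ m1; have f2 := fin_num_measure Q _ m2.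
by move: E; rewrite -(fineK f1) -(fineK f2) -!EFinB => -[/addrI/oppr_inj ->].
Qed.

(** * The normal distribution function and superuniformity *)

Lemma Phi_le (R : realType) (x y : R) : x <= y -> Phi x <= Phi y.
Proof.
move=> xy; rewrite /Phi fine_le//.
- by apply: (@fin_num_measure _ _ _ (normal_prob 0 1)).
- by apply: (@fin_num_measure _ _ _ (normal_prob 0 1)).
apply: (@le_measure _ _ _ (normal_prob 0 1)); rewrite ?inE//.
by apply: subset_itvl; rewrite bnd_simp.
Qed.

(** The density is at most its peak, the inverse square root of [2 * pi], which is at most 1/2 since
    [pi >= 2]. *)
Lemma Phi_lipschitz (R : realType) (x y : R) : x <= y -> Phi y - Phi x <= 2^-1 * (y - x).
Proof.
move=> xy.
have fin (A : set R) : measurable A -> normal_prob 0 1 A \is a fin_num.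
  by move=> mA; apply: (@fin_num_measure _ _ _ (normal_prob 0 1)).
have -> : Phi y = Phi x + fine (normal_prob 0 1 `]x, y]).
  rewrite /Phi -fineD ?fin//; congr fine.
  rewrite -[RHS](@measureU _ _ _ (normal_prob 0 1))//.
    by congr (normal_prob 0 1 _); rewrite -itv_bndbnd_setU.
  apply/seteqP; split => // z /=; rewrite !in_itv/= => -[zx /andP[]].
  by rewrite ltNge zx.
rewrite addrAC subrr add0r -lee_fin fineK ?fin//.
apply: (@le_trans _ _ (\int[lebesgue_measure]_(z in `]x, y]) (2^-1)%:E)%E).
  apply: ge0_le_integral => //=.
  - by move=> z _; rewrite lee_fin normal_pdf_ge0.
  - by apply/measurable_EFinP/measurable_funTS; exact: measurable_normal_pdf.
  - move=> z _; rewrite lee_fin; apply: (le_trans (normal_pdf_ub _ _ (oner_neq0 _))).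
    rewrite /normal_peak expr1n mul1r lef_pV2 ?posrE//; last first.
      by rewrite sqrtr_gt0 mulrn_wgt0// pi_gt0.
    have -> : 2 = Num.sqrt (2 ^+ 2) :> R by rewrite sqrtr_sqr ger0_norm.
    by apply: ler_wsqrtr; have := pi_ge2 R; lra.
rewrite integral_cst//= lebesgue_measure_itv/= lte_fin.
move: xy; rewrite le_eqVlt => /predU1P[->|xy]; first by rewrite ltxx mule0 subrr mulr0.
by rewrite xy -EFinB -EFinM.
Qed.

(* Superuniformity of [F M], where [E c] stands for [M <= c] and [F] is the distribution
   function of [M]: [W] is the event [F M <= alpha]. *)
Lemma probability_union_level_le (R : realType) d (T : measurableType d)
    (P : probability T R) (E : R -> set T) (alpha : R) :
  0 <= alpha -> (forall c, measurable (E c)) -> (forall b c, b <= c -> E b `<=` E c) ->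
  exists2 W, measurable W /\ (forall c x, fine (P (E c)) <= alpha -> E c x -> W x) &
    (P W <= alpha%:E)%E.
Proof.
move=> a0 mE Emono; pose S := [set c | fine (P (E c)) <= alpha].
have fin c : P (E c) \is a fin_num by exact: fin_num_measure.
have [S0|/set0P/negP/negPn/eqP S0] := pselect (S !=set0); last first.
  exists set0; last by rewrite measure0.
  by split => // c x Sc _; have : set0 c by rewrite -S0.
have Sdown x y : y <= x -> S x -> S y.
  move=> yx; apply: le_trans; rewrite fine_le// le_measure ?inE//.
  exact: Emono.
have [c [cmono Sc cS]] := down_closed_half_lines S0 Sdown.
(* The supremum of [S] may lie outside [S], so [W] is an increasing union over points of [S] that
   exhaust it. Each [E (c k)] has probability at most [alpha], and continuity from below carries
   this over to [W]. *)
exists (\bigcup_k E (c k)).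
  split; first exact: bigcup_measurable.
  by move=> b x /cS[k bk] Ex; exists k => //; exact: Emono Ex.
have cv : (P \o (fun k => E (c k))) @ \oo --> P (\bigcup_k E (c k)).
  apply: nondecreasing_cvg_mu => //; first exact: bigcup_measurable.
  by move=> m n mn; apply/subsetPset; apply: Emono; exact: cmono.
rewrite -(cvg_lim _ cv)//; apply: lime_le; first by apply/cvg_ex; eexists; exact: cv.
by apply: nearW => k /=; rewrite -(fineK (fin _)) lee_fin; exact: Sc.
Qed.

(** * The bias of the ridge estimator *)

(* The spectral theorem is available over algebraically closed fields only, hence
   the detour through the complex numbers. *)
Lemma real_symmetric_spectral (R : realType) n (S : 'M[R]_n) : S^T = S ->
  exists d : 'I_n -> R, exists Q : 'M[R[i]]_n,
    Q \is spectral.unitarymx /\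
    map_mx (real_complex R) S =
      (map_mx Num.conj Q^T) *m diag_mx (\row_i (d i)%:C%C) *m Q.
Proof.
move=> symS; pose SC := map_mx (real_complex R) S.
have hS : SC \is hermsymmx.
  rewrite is_hermitianmxE expr0 scale1r; apply/eqP/matrixP => i j.
  by rewrite !mxE -[in RHS]symS mxE; apply/esym/conjc_real.
have := hermitian_spectral_diag_real hS; have /hermitian_normalmx/orthomx_spectralP SE := hS.
move=> /mxOverP dr.
exists (fun i => complex.Re (spectral_diag SC 0 i)), (spectralmx SC).
split; first exact: spectral_unitarymx.
rewrite -(invmx_unitary (spectral_unitarymx SC)) [LHS]SE; congr (_ *m diag_mx _ *m _).
by apply/rowP => i; rewrite mxE RRe_real.
Qed.

(** Conjugation by a unitary matrix keeps determinants, so [S - a%:M] has determinant the product of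
    the [d i - a]. *)
Lemma real_symmetric_eigenvalue (R : realType) n (S : 'M[R]_n) (d : 'I_n -> R) (Q : 'M[R[i]]_n) a :
  Q \is spectral.unitarymx ->
  map_mx (real_complex R) S =
    (map_mx Num.conj Q^T) *m diag_mx (\row_i (d i)%:C%C) *m Q ->
  eigenvalue S a <-> exists i, d i = a.
Proof.
move=> QU SE.
have QQ := unitarymxP QU; have QQ' := mulmx1C QQ.
have e1 : eigenvalue S a = (\det (S - a%:M) == 0).
  rewrite /eigenvalue /eigenspace kermx_eq0 row_free_unit unitmxE unitfE.
  by rewrite negbK.
have e2 : (\det (S - a%:M) == 0) = (\prod_i ((d i)%:C%C - a%:C%C) == 0 :> R[i]).
  rewrite -(fmorph_eq0 (real_complex R)) -det_map_mx map_mxB SE map_scalar_mx.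
  have -> : (map_mx Num.conj Q^T) *m diag_mx (\row_i (d i)%:C%C) *m Q - (a%:C%C)%:M =
      (map_mx Num.conj Q^T) *m diag_mx (\row_i ((d i)%:C%C - a%:C%C)) *m Q.
    have -> : diag_mx (\row_i ((d i)%:C%C - a%:C%C)) =
        diag_mx (\row_i (d i)%:C%C) - (a%:C%C)%:M.
      by apply/matrixP => i j; rewrite !mxE; case: (i == j); rewrite ?mulr1n ?mulr0n ?subr0.
    by rewrite mulmxBr mulmxBl -scalemx1 -scalemxAr mulmx1 -scalemxAl QQ'.
  rewrite !det_mulmx mulrAC -det_mulmx QQ' det1 mul1r det_diag.
  by under eq_bigr do rewrite mxE.
rewrite e1 e2; split.
  move/eqP/eqP; rewrite prodf_seq_eq0 => /hasP[i _ /=]; rewrite subr_eq0 => /eqP/complexI <-.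
  by exists i.
by move=> [i <-]; rewrite (bigD1 i)//= subrr mul0r.
Qed.

(** [c i] is the squared modulus of the spectral coordinate [i] of [u]. One [c] serves every [B]
    diagonalised by [Q], which permits comparing norms term by term. *)
Lemma real_symmetric_norm (R : realType) n (Q : 'M[R[i]]_n) (u : 'cV[R]_n) :
  Q \is spectral.unitarymx ->
  exists c : 'I_n -> R, (forall i, 0 <= c i) /\
    forall (B : 'M[R]_n) (e : 'I_n -> R),
    map_mx (real_complex R) B =
      (map_mx Num.conj Q^T) *m diag_mx (\row_i (e i)%:C%C) *m Q ->
    \sum_i ((B *m u) i 0) ^+ 2 = \sum_i e i ^+ 2 * c i.
Proof.
move=> QU; have QQ := unitarymxP QU.
pose y := Q *m map_mx (real_complex R) u.
pose c i := complex.Re (y i 0) ^+ 2 + complex.Im (y i 0) ^+ 2.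
have cE i : ((c i)%:C)%C = (y i 0)^* * y i 0.
  by rewrite /c; case: (y i 0) => a b; rewrite /Num.conj/=; simpc; congr Complex; ring.
exists c; split; first by move=> i; rewrite addr_ge0 ?sqr_ge0.
move=> B e BE; apply: (@complexI R); rewrite !rmorph_sum/=.
pose z := map_mx (real_complex R) (B *m u).
have zE : z = (map_mx Num.conj Q^T) *m (diag_mx (\row_i (e i)%:C%C) *m y).
  by rewrite /z map_mxM BE /y !mulmxA.
transitivity ((map_mx Num.conj z^T *m z) 0 0).
  rewrite mxE; apply: eq_bigr => i _; rewrite !mxE -/z rmorphXn /= expr2; congr (_ * _).
  by apply/esym/conjc_real.
pose w := diag_mx (\row_i (e i)%:C%C) *m y.
have -> : map_mx Num.conj z^T = map_mx Num.conj w^T *m Q.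
  rewrite zE trmx_mul map_mxM; congr (_ *m _).
  by apply/matrixP => i j; rewrite !mxE; exact: conjcK.
have wE i : w i 0 = ((e i)%:C)%C * y i 0.
  by rewrite /w mul_diag_mx mxE; congr (_ * _); rewrite mxE.
rewrite zE mulmxA -[_ *m Q *m _]mulmxA QQ mulmx1 -/w mxE; apply: eq_bigr => i _.
have -> : (map_mx Num.conj w^T) 0 i = Num.conj (w i 0) by rewrite mxE [in LHS]mxE.
rewrite wE rmorphM [in RHS]expr2 !rmorphM /= cE.
have -> : Num.conj ((e i)%:C)%C = ((e i)%:C)%C :> R[i] by exact: conjc_real.
by ring.
Qed.

Lemma dot_mx_ge0 (R : realType) m n (B : 'M[R]_(m, n)) i : 0 <= (B^T *m B) i i.
Proof. by rewrite mxE sumr_ge0// => j _; rewrite mxE -expr2 sqr_ge0. Qed.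

Lemma mulmx_tr_eq0 (R : realType) m n (B : 'M[R]_(m, n)) : B *m B^T = 0 -> B = 0.
Proof.
move=> B0; apply/matrixP => i j; rewrite mxE.
have /matrixP/(_ i i) := B0; rewrite !mxE => /eqP; rewrite psumr_eq0; last first.
  by move=> k _; rewrite mxE -expr2 sqr_ge0.
by move=> /allP/(_ j (mem_index_enum _)); rewrite mxE -expr2 sqrf_eq0 => /eqP.
Qed.

(** In spectral coordinates the squared norms have terms [d i ^+ 2 * c i] and
    [((d i + l) * d i) ^+ 2 * c i]. Both vanish if [d i = 0]; otherwise [d i + l] is at least the
    smallest nonzero eigenvalue. *)
Lemma ridge_operator_bound (R : realType) n (S : 'M[R]_n) (l : R) (u : 'cV[R]_n) :
  S^T = S -> (forall v : 'rV[R]_n, 0 <= (v *m S *m v^T) 0 0) -> 0 <= l ->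
  norm2 (S *m u) <= norm2 ((S + l%:M) *m (S *m u)) / lambda_min_nz S.
Proof.
move=> symS psd l0.
have [d [Q [QU SE]]] := real_symmetric_spectral symS.
have evE a := real_symmetric_eigenvalue a QU SE.
have d0 i : 0 <= d i.
  have /eigenvalueP[v vS vn0] : eigenvalue S (d i) by apply/evE; exists i.
  have := psd v; rewrite vS -scalemxAl mxE.
  have v0 : 0 < (v *m v^T) 0 0.
    rewrite lt_neqAle eq_sym; apply/andP; split; last first.
      by have := dot_mx_ge0 v^T 0; rewrite trmxK.
    apply: contra_neq vn0 => vv; apply: mulmx_tr_eq0.
    by apply/matrixP => a b; rewrite !ord1 vv mxE.
  by rewrite pmulr_lge0.
have [c [c0 cE]] := real_symmetric_norm u QU.
have e1 := cE S d SE.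
have e2 := cE ((S + l%:M) *m S) (fun i => (d i + l) * d i).
set m := lambda_min_nz S.
have m_le i : d i != 0 -> m <= d i.
  move=> din0; apply: ge_inf; last by split=> //; apply/evE; exists i.
  by exists 0 => a [/evE[k <-] _].
(* If all [d i] vanish, so does the left side, and only [m >= 0] is required; the infimum of the
   empty set is 0. *)
have [[i0 di0]|nod] := pselect (exists i, d i != 0); last first.
  have -> : norm2 (S *m u) = 0.
    rewrite /norm2 e1 big1 ?sqrtr0// => i _.
    suff -> : d i = 0 by rewrite expr0n mul0r.
    by apply/eqP/negP => /negP din0; apply: nod; exists i.
  rewrite divr_ge0 ?sqrtr_ge0// /m /lambda_min_nz.
  have [->|/set0P[a [aS an0]]] := eqVneq [set a : R | eigenvalue S a /\ a != 0] set0.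
    by rewrite inf0.
  apply: lb_le_inf; first by exists a.
  by move=> b [/evE[k <-] _].
have m_gt0 : 0 < m.
  (* The infimum is over finitely many positive numbers, hence bounded below by the smallest of
     them. *)
  pose k := [arg min_(i < i0 | d i != 0) d i]%O.
  have [kn0 kmin] : d k != 0 /\ forall i, d i != 0 -> d k <= d i.
    by rewrite /k; case: arg_minP => // i din0 imin; split.
  apply: (@lt_le_trans _ _ (d k)); first by rewrite lt_neqAle eq_sym kn0 d0.
  apply: lb_le_inf; first by exists (d i0); split => //; apply/evE; exists i0.
  by move=> b [/evE[i <-] din0]; exact: kmin.
rewrite ler_pdivlMr// /norm2 mulmxA.
have -> : m = Num.sqrt (m ^+ 2) by rewrite sqrtr_sqr gtr0_norm.
rewrite -sqrtrM ?sumr_ge0//; last by move=> i _; exact: sqr_ge0.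
apply: ler_wsqrtr; rewrite e1 e2; last first.
  rewrite map_mxM.
  have -> : ((\row_i ((d i + l) * d i)%:C%C) : 'rV[R[i]]_n) =
      \row_i ((\row_i (d i + l)%:C%C) 0 i * (\row_i (d i)%:C%C) 0 i).
    by apply/rowP => i; rewrite !mxE rmorphM.
  have -> : map_mx (real_complex R) (S + l%:M) =
      map_mx Num.conj Q^T *m diag_mx (\row_i (d i + l)%:C%C) *m Q.
    rewrite map_mxD map_scalar_mx SE.
    have -> : diag_mx (\row_i (d i + l)%:C%C) =
        diag_mx (\row_i (d i)%:C%C) + (l%:C%C)%:M :> 'M[R[i]]_n.
      by apply/matrixP => i j; rewrite !mxE; case: (i == j); rewrite ?mulr1n ?mulr0n ?addr0// rmorphD.
    by rewrite mulmxDr mulmxDl -scalemx1 -scalemxAr mulmx1 -scalemxAl (mulmx1C (unitarymxP QU)).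
  rewrite SE !mulmxA -[_ *m Q *m map_mx _ _]mulmxA (unitarymxP QU) mulmx1.
  by rewrite -[_ *m diag_mx _ *m diag_mx _]mulmxA mulmx_diag.
rewrite mulr_suml; apply: ler_sum => i _.
have [->|din0] := eqVneq (d i) 0; first by rewrite expr0n !(mul0r, mulr0) expr0n mul0r.
rewrite mulrAC [in leRHS]exprMn ler_wpM2r// mulrC ler_wpM2r ?sqr_ge0//.
rewrite lerXn2r// ?nnegrE ?addr_ge0//; first exact: ltW.
by rewrite (le_trans (m_le i din0))// lerDl.
Qed.

(** * Application to the ridge estimator *)

Lemma Sigma_hat_sym (R : realType) n p (X : 'M[R]_(n, p)) : (Sigma_hat X)^T = Sigma_hat X.
Proof.
apply/matrixP => i j; rewrite !mxE; congr (_ * _).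
by apply: eq_bigr => k _; rewrite !mxE mulrC.
Qed.

Lemma Sigma_hat_psd (R : realType) n p (X : 'M[R]_(n, p)) (v : 'rV[R]_p) :
  0 <= (v *m Sigma_hat X *m v^T) 0 0.
Proof.
rewrite /Sigma_hat -scalemxAr -scalemxAl mxE mulr_ge0 ?invr_ge0//.
have -> : v *m (X^T *m X) *m v^T = (X *m v^T)^T *m (X *m v^T).
  by rewrite trmx_mul trmxK !mulmxA.
exact: dot_mx_ge0.
Qed.

(** The matrix is positive definite: its quadratic form is a nonnegative one plus [lam] times the
    squared norm. *)
Lemma ridge_matrix_unit (R : realType) n p (X : 'M[R]_(n, p)) (lam : R) : 0 < lam ->
  Sigma_hat X + lam%:M \in unitmx.
Proof.
move=> l0; rewrite -row_free_unit; apply: inj_row_free => v vA0.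
have : (v *m (Sigma_hat X + lam%:M) *m v^T) 0 0 = 0 by rewrite vA0 mul0mx mxE.
rewrite mulmxDr mulmxDl mxE => /eqP; rewrite paddr_eq0 ?Sigma_hat_psd//; last first.
  rewrite mul_mx_scalar -scalemxAl mxE mulr_ge0 ?(ltW l0)//.
  by have := dot_mx_ge0 v^T 0; rewrite trmxK.
move=> /andP[_]; rewrite mul_mx_scalar -scalemxAl mxE mulf_eq0 (gt_eqF l0)/= => /eqP vv.
by apply: mulmx_tr_eq0; apply/matrixP => a b; rewrite !ord1 vv mxE.
Qed.

(** This says that [X *m PX X G = X]. With [M = X *m X^T], the difference is [(M *m G - 1%:M) *m X],
    and its product with its own transpose contains [(M *m G - 1%:M) *m M = 0]. *)
Lemma mul_MP_row_space (R : realType) n p (X : 'M[R]_(n, p)) (G : 'M[R]_n) :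
  is_MP_inv (X *m X^T) G -> X *m X^T *m G *m X = X.
Proof.
move=> [MGM _ MGT _]; apply/eqP; rewrite -subr_eq0; apply/eqP.
set M := X *m X^T in MGM MGT *.
apply: mulmx_tr_eq0.
have -> : M *m G *m X - X = (M *m G - 1%:M) *m X by rewrite mulmxBl mul1mx.
rewrite trmx_mul mulmxA -[_ *m X *m X^T]mulmxA -/M.
by rewrite [_ *m M]mulmxBl MGM mul1mx subrr mul0mx.
Qed.

(** The ridge estimator as a linear map of the response; applied to [eps] it gives the noise
    part. *)
Definition ridge_noise (R : realType) n p (X : 'M[R]_(n, p)) (lam : R) : 'M[R]_(p, n) :=
  (n%:R)^-1 *: (invmx (Sigma_hat X + lam%:M) *m X^T).

(** Gives the noise part the covariance prescribed for [Z]. Of the two factors [1/n], one is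
    absorbed into [Sigma_hat]. *)
Lemma ridge_noise_cov (R : realType) n p (X : 'M[R]_(n, p)) (lam sigma : R) : 0 < lam ->
  sigma ^+ 2 *: (ridge_noise X lam *m (ridge_noise X lam)^T) =
  ((n%:R)^-1 * sigma ^+ 2) *: Omega X lam.
Proof.
move=> l0; rewrite /ridge_noise /Omega.
set A := Sigma_hat X + lam%:M.
have AT : A^T = A.
  rewrite /A -{2}Sigma_hat_sym; apply/matrixP => i j; rewrite !mxE eq_sym.
  by congr (_ + _ *+ _); case: eqP.
have iAT : (invmx A)^T = invmx A by rewrite trmx_inv AT.
have trZ (a : R) (B : 'M[R]_(p, n)) : (a *: B)^T = a *: B^T by apply/matrixP => i j; rewrite !mxE.
rewrite trZ trmx_mul trmxK iAT /Sigma_hat; clearbody A.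
rewrite -![_ *m (_ *: _)]scalemxAr -!scalemxAl !scalerA.
by rewrite !mulmxA; congr (_ *: _); ring.
Qed.

Lemma coord_le_norm2 (R : realType) p (v : 'cV[R]_p) j : `|v j 0| <= norm2 v.
Proof.
rewrite /norm2 -sqrtr_sqr; apply: ler_wsqrtr.
by rewrite (bigD1 j)//= lerDl sumr_ge0// => i _; exact: sqr_ge0.
Qed.

(** The ridge mean is [theta - lam *: (invmx A *m theta)]. Since [beta j 0 = 0], [theta j 0] is a
    sum over [k != j] only and merges with the correction by [binit]; the second term is the bias
    [b]. *)
Lemma beta_corr_null (R : realType) n p (X : 'M[R]_(n, p)) (G : 'M[R]_n) (lam : R)
    (beta binit : 'cV[R]_p) (e : 'cV[R]_n) j :
  (0 < n)%N -> 0 < lam -> is_MP_inv (X *m X^T) G -> beta j 0 = 0 ->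
  exists2 b, `|b| <= lam * norm2 (PX X G *m beta) / lambda_min_nz (Sigma_hat X) &
  beta_corr X G lam (X *m beta + e) binit j =
    (ridge_noise X lam *m e) j 0 + b
    - \sum_(k | k != j) PX X G j k * (binit k 0 - beta k 0).
Proof.
move=> n0 l0 MP bj0.
have nn0 : n%:R != 0 :> R by rewrite pnatr_eq0 -lt0n.
have Au := ridge_matrix_unit X l0.
have MGX := mul_MP_row_space MP; have [_ _ MGT _] := MP.
set S := Sigma_hat X in Au *; set A := S + lam%:M in Au *.
pose theta := PX X G *m beta.
have SP : S *m PX X G = S.
  rewrite /S /PX /Sigma_hat -scalemxAl; congr (_ *: _).
  rewrite -mulmxA !mulmxA -[X^T *m X *m X^T]mulmxA -!mulmxA.
  by rewrite [X *m (X^T *m _)]mulmxA [X *m X^T *m _]mulmxA MGX.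
(* The transpose of [MGX], as [X *m X^T *m G] is symmetric. It exhibits [theta] as [S *m u], in the
   range of [S]. *)
have XT : X^T = n%:R *: (S *m (X^T *m G)).
  rewrite /S /Sigma_hat -scalemxAl scalerA mulfV// scale1r.
  rewrite -!mulmxA [X *m (X^T *m _)]mulmxA.
  by rewrite -MGT -trmx_mul MGX.
pose u := n%:R *: ((X^T *m G) *m (G *m (X *m beta))).
have thetaE : theta = S *m u.
  rewrite /theta /PX {1}XT /u -![(n%:R *: _) *m _]scalemxAl -[S *m (n%:R *: _)]scalemxAr; congr (_ *: _).
  by rewrite !mulmxA.
have ASC : invmx A *m S = S *m invmx A.
  have AS : A *m S = S *m A by rewrite /A mulmxDl mulmxDr mul_scalar_mx mul_mx_scalar.
  by rewrite -[LHS](mulmxK Au) -[_ *m S *m A]mulmxA -AS mulmxA mulVmx// mul1mx.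
exists (- lam * (invmx A *m theta) j 0).
  rewrite mulNr normrN normrM gtr0_norm// -mulrA ler_wpM2l ?(ltW l0)//.
  apply: (le_trans (coord_le_norm2 _ _)); rewrite -/theta.
  have -> : invmx A *m theta = S *m (invmx A *m u) by rewrite thetaE !mulmxA ASC.
  have h := ridge_operator_bound (invmx A *m u) (Sigma_hat_sym X) (Sigma_hat_psd X) (ltW l0).
  apply: (le_trans h); rewrite -/S -/A.
  by rewrite [S *m _]mulmxA -ASC -mulmxA -thetaE mulKVmx.
have -> : beta_corr X G lam (X *m beta + e) binit j =
   ridge X lam (X *m beta + e) j 0 - \sum_(k | k != j) PX X G j k * binit k 0 by [].
have -> : ridge X lam (X *m beta + e) = theta - lam *: (invmx A *m theta) + ridge_noise X lam *m e.
  rewrite /ridge /ridge_noise -/S -/A mulmxDr scalerDr mulmxDr; congr (_ + _).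
    have -> : n%:R^-1 *: (X^T *m (X *m beta)) = S *m theta.
      by rewrite /theta [RHS]mulmxA SP /S /Sigma_hat -scalemxAl -mulmxA.
    have -> : S = A - lam%:M by rewrite /A addrK.
    by rewrite mulmxBl mul_scalar_mx mulmxBr mulKmx// -scalemxAr.
  by rewrite -scalemxAl -scalemxAr mulmxA.
have -> : \sum_(k | k != j) PX X G j k * (binit k 0 - beta k 0) =
   \sum_(k | k != j) PX X G j k * binit k 0 - theta j 0.
  rewrite [theta j 0]mxE (bigD1 j (P := xpredT))//= bj0 mulr0 add0r -sumrB.
  by apply: eq_bigr => k _; rewrite mulrBr.
have cD (a b : 'cV[R]_p) : (a + b) j 0 = a j 0 + b j 0 by rewrite mxE.
have cN (a : 'cV[R]_p) : (- a) j 0 = - a j 0 by rewrite mxE.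
have cZ (l : R) (a : 'cV[R]_p) : (l *: a) j 0 = l * a j 0 by rewrite mxE.
by rewrite !cD cN cZ; ring.
Qed.

(** * The familywise error *)

Lemma limn_esup_le_add_cvg0 (R : realType) (v : nat -> \bar R) (u : nat -> R) (c : R) :
  u @ \oo --> 0 -> (\forall n \near \oo, (v n <= (c + u n)%:E)%E) ->
  (limn_esup v <= c%:E)%E.
Proof.
move=> u0 vu; apply/lee_addgt0Pr => e e0.
have A : \forall n \near \oo, (v n <= c%:E + e%:E)%E.
  near=> n; apply: (@le_trans _ _ ((c + u n)%:E)); first by near: n.
  by rewrite -EFinD lee_fin lerD2l; near: n; exact: (cvgr_le _ u0).
apply: (@le_trans _ _ (ereal_sup (v @` [set n | (v n <= c%:E + e%:E)%E]))).
  by apply: ereal_inf_lbound; exists [set n | (v n <= c%:E + e%:E)%E].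
by apply: ge_ereal_sup => _ [n /= vn <-].
Unshelve. all: by end_near. Qed.

Lemma measurable_norm_le (R : realType) d (T : measurableType d) (h : T -> R) (c : R) :
  measurable_fun setT h -> measurable [set w | `|h w| <= c].
Proof.
move=> mh; rewrite (_ : [set _ | _] = (fun w => `|h w|) @^-1` `]-oo, c]); last first.
  by apply/seteqP; split => w /=; rewrite in_itv.
rewrite -[X in measurable X]setTI.
by apply: (measurableT_comp (f := fun y : R => `|y|) _ mh).
Qed.

Lemma ridgeE (R : realType) n p (X : 'M[R]_(n, p)) (lam : R) (Y : 'cV[R]_n) :
  ridge X lam Y = ridge_noise X lam *m Y.
Proof. by rewrite /ridge /ridge_noise -scalemxAl -scalemxAr mulmxA. Qed.

Lemma measurable_beta_corr (R : realType) d (T : measurableType d) n p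
    (X : 'M[R]_(n, p)) (G : 'M[R]_n) (lam : R) (Y : T -> 'cV[R]_n)
    (binit : T -> 'cV[R]_p) j :
  (forall i, measurable_fun setT (fun w => Y w i 0)) ->
  (forall k, measurable_fun setT (fun w => binit w k 0)) ->
  measurable_fun setT (fun w => beta_corr X G lam (Y w) (binit w) j).
Proof.
move=> mY mb; rewrite /beta_corr; under eq_fun do rewrite ridgeE mxE.
apply: measurable_funB.
  by apply: measurable_sum => i; exact: measurable_funM.
under eq_fun do rewrite big_mkcond/=.
apply: measurable_sum => k; case: (k != j) => //.
exact: measurable_funM.
Qed.

Lemma measurable_Phi (R : realType) : measurable_fun setT (@Phi R).
Proof. by apply: nondecreasing_measurable => // x y; exact: Phi_le. Qed.

Lemma measurable_pval (R : realType) d (T : measurableType d) n p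
    (X : 'M[R]_(n, p)) (G : 'M[R]_n) (lam sigma : R) (Delta : 'I_p -> R)
    (Y : T -> 'cV[R]_n) (binit : T -> 'cV[R]_p) j :
  (forall i, measurable_fun setT (fun w => Y w i 0)) ->
  (forall k, measurable_fun setT (fun w => binit w k 0)) ->
  measurable_fun setT (fun w => pval X G lam sigma Delta (Y w) (binit w) j).
Proof.
move=> mY mb; rewrite /pval; apply: measurable_funM => //.
apply: measurable_funB => //; apply: (measurableT_comp (@measurable_Phi R)).
apply: measurable_maxr => //; apply: measurable_funB => //.
apply: measurable_funM => //; apply: measurableT_comp => //.
exact: measurable_beta_corr.
Qed.

Lemma a_coef_ge0 (R : realType) n p (sigma : R) (Om : 'M[R]_p) (j : 'I_p) :
  0 < sigma -> 0 <= a_coef n sigma Om j.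
Proof. by move=> s0; rewrite !divr_ge0 ?sqrtr_ge0 ?(ltW s0). Qed.

Lemma Omega_min_le (R : realType) p (Om : 'M[R]_p) j : Omega_min Om <= Om j j.
Proof.
apply: ge_inf; last by exists j.
exists (- \sum_i `|Om i i|) => _ [i _ <-].
rewrite lerNl (bigD1 i)//=.
apply: (@le_trans _ _ `|Om i i|); first by rewrite -normrN ler_norm.
by rewrite lerDl sumr_ge0.
Qed.

(** Replacing the diagonal entry by [Omega_min] turns the scaled bias into the rate of the theorem
    over [sigma], uniformly in [j]. *)
Lemma a_coef_bias_le (R : realType) n p (sigma l : R) (Om : 'M[R]_p) (j : 'I_p) (N m b : R) :
  0 < sigma -> 0 < Omega_min Om -> `|b| <= l * N / m ->
  a_coef n sigma Om j * `|b| <=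
  (Num.sqrt n%:R * N * l * (Num.sqrt (Omega_min Om))^-1 * m^-1) / sigma.
Proof.
move=> s0 Om0 bl; have Omj := Omega_min_le Om j.
have a_le : a_coef n sigma Om j <= Num.sqrt n%:R / sigma / Num.sqrt (Omega_min Om).
  rewrite /a_coef ler_wpM2l// ?divr_ge0 ?sqrtr_ge0 ?(ltW s0)//.
  by rewrite lef_pV2 ?posrE ?sqrtr_gt0 ?(lt_le_trans Om0)// ler_wsqrtr.
apply: (le_trans (ler_pM (a_coef_ge0 _ _ _ s0) (normr_ge0 b) a_le bl)).
by rewrite le_eqVlt; apply/orP; left; apply/eqP; ring.
Qed.

(** The whole argument at a fixed [n]: the asymptotics enter only through the bound of the rate by
    [zeta] and the probability of [good]. *)
Lemma family_error_le (R : realType) n p d dZ (T : measurableType d)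
    (TZ : measurableType dZ) (P : probability T R) (Q : probability TZ R)
    (X : 'M[R]_(n, p)) (beta : 'cV[R]_p) (sigma : R) (eps : T -> 'cV[R]_n)
    (lam : R) (G : 'M[R]_n) (binit : T -> 'cV[R]_p) (Delta : 'I_p -> R)
    (Z : TZ -> 'cV[R]_p) (zeta alpha : R) :
  let Om := Omega X lam in
  let a := a_coef n sigma Om in
  let good := [set w | forall j : 'I_p,
    `| a j * \sum_(k | k != j) PX X G j k * (binit w k 0 - beta k 0) | <= Delta j] in
  (0 < n)%N -> 0 < sigma -> iid_normal P eps sigma -> 0 < lam ->
  is_MP_inv (X *m X^T) G -> 0 < Omega_min Om ->
  (forall j, measurable_fun setT (fun w => binit w j 0)) ->
  gaussian_vec Q Z (((n%:R)^-1 * sigma ^+ 2) *: Om) ->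
  (Num.sqrt n%:R * norm2 (PX X G *m beta) * lam * (Num.sqrt (Omega_min Om))^-1
     * (lambda_min_nz (Sigma_hat X))^-1) / sigma <= zeta ->
  0 <= alpha ->
  measurable [set w | exists j, beta j 0 = 0 /\ FZ Q Z a
     (pval X G lam sigma Delta (X *m beta + eps w) (binit w) j + zeta) <= alpha] /\
  (P [set w | exists j, beta j 0 = 0 /\ FZ Q Z a
     (pval X G lam sigma Delta (X *m beta + eps w) (binit w) j + zeta) <= alpha]%R
   <= (alpha + (1 - fine (P good)))%:E)%E.
Proof.
move=> Om a good n0 s0 iid l0 MP Om0 mb gZ rate a0.
have [meps _] := iid.
have agt0 j : 0 <= a j by exact: a_coef_ge0.
pose Zt w := ridge_noise X lam *m eps w.
have gZt : gaussian_vec P Zt (((n%:R)^-1 * sigma ^+ 2) *: Om).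
  have h := gaussian_vec_mulmx (ridge_noise X lam) s0 iid.
  by rewrite (ridge_noise_cov X sigma l0) in h.
pose pt j x := 2 * (1 - Phi (a j * x)).
have pt_ni j x y : x <= y -> pt j y <= pt j x.
  by move=> xy; rewrite ler_wpM2l// lerD2l lerN2 Phi_le// ler_wpM2l.
pose U c j := [set x | pt j x <= c].
have Uup c j x y : x <= y -> U c j x -> U c j y.
  by move=> xy; exact: le_trans (pt_ni _ _ _ xy).
pose E c := [set w | exists j, U c j `|Zt w j 0|].
(* Equality in law makes [FZ], computed from [Z] under [Q], the distribution function of the noise
   minimum under [P]. *)
have FZE c : FZ Q Z a c = fine (P (E c)).
  by rewrite /FZ /E (cramer_wold_exceed gZt gZ (Uup c)).
have mE c : measurable (E c) by exact: measurable_norm_exceed gZt.1 (Uup c).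
have Emono b c : b <= c -> E b `<=` E c.
  by move=> bc w [j Uj]; exists j; exact: le_trans Uj bc.
have FZmono : {homo FZ Q Z a : b c / b <= c}.
  move=> b c bc; rewrite !FZE fine_le// ?fin_num_measure//.
  by apply: le_measure; rewrite ?inE//; exact: Emono.
have mY i : measurable_fun setT (fun w => (X *m beta + eps w) i 0).
  by under eq_fun do rewrite mxE; exact: measurable_funD.
set V := [set w | exists j, _].
have mV : measurable V.
  rewrite (_ : V = \bigcup_(j in [set j | beta j 0 = 0]) ((fun w => FZ Q Z a
     (pval X G lam sigma Delta (X *m beta + eps w) (binit w) j + zeta)) @^-1` `]-oo, alpha])).
    apply: fin_bigcup_measurable => [|j _]; first exact: finite_finset.
    rewrite -[X in measurable X]setTI; apply: (measurableT_comp (f := FZ Q Z a)) => //.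
      by apply: nondecreasing_measurable.
    by apply: measurable_funD => //; exact: measurable_pval.
  apply/seteqP; split => w /=.
    by move=> [j [bj Fj]]; exists j => //=; rewrite in_itv.
  by move=> [j bj] /=; rewrite in_itv => Fj; exists j.
split => //.
have mgood : measurable good.
  rewrite (_ : good = \bigcap_(j in [set: 'I_p]) [set w | `| a j *
      \sum_(k | k != j) PX X G j k * (binit w k 0 - beta k 0) | <= Delta j]).
    apply: fin_bigcap_measurable => [|j _]; first exact: finite_finset.
    apply: measurable_norm_le; apply: measurable_funM => //.
    under eq_fun do rewrite big_mkcond/=.
    apply: measurable_sum => k; case: (k != j) => //.
    by apply: measurable_funM => //; exact: measurable_funB.
  by apply/seteqP; split => w /=; [move=> H j _; exact: H|move=> H j; exact: H].
have [W [mW EW] PW] := probability_union_level_le P a0 mE Emono.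
have VW : V `<=` W `|` ~` good.
  move=> w [j [bj Fj]]; have [gw|] := pselect (good w); last by right.
  left; apply: EW (pval X G lam sigma Delta (X *m beta + eps w) (binit w) j + zeta) _ _ _.
    by rewrite -FZE.
  exists j; rewrite /U/= /pt.
  have [b b_le bE] := beta_corr_null (binit w) (eps w) n0 l0 MP bj.
  have := a_coef_bias_le n j s0 Om0 b_le; rewrite -/(a j).
  set r := (X in X / sigma <= zeta) in rate *; rewrite -/r => ab.
  have r0 : 0 <= r / sigma by apply: le_trans ab; rewrite mulr_ge0.
  set z := `|Zt w j 0|.
  have z0 : 0 <= a j * z by exact: mulr_ge0 (agt0 j) (normr_ge0 _).
  set x := Num.max 0 (a j * `|beta_corr X G lam (X *m beta + eps w) (binit w) j| - Delta j).
  (* On [good] the error of the initial estimator is at most [Delta j], the amount that the p-value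
     subtracts. *)
  have x_le : x <= a j * z + r / sigma.
    rewrite ge_max addr_ge0//= bE -/(Zt w) lerBlDr.
    have := gw j; set s := \sum_(k | _) _ => gj.
    have -> : forall y, a j * `|y| = `|a j * y| by move=> y; rewrite normrM ger0_norm.
    rewrite mulrBr mulrDr (le_trans (ler_normB _ _))// lerD//.
    rewrite (le_trans (ler_normD _ _))// normrM [X in _ + X]normrM !(ger0_norm (agt0 j)).
    exact: lerD.
  rewrite /pval -/x.
  have h1 := Phi_le x_le.
  (* The constant 1/2 cancels the factor 2 of the p-value, so the bias costs [r / sigma], which
     [zeta] covers. *)
  have h2 : Phi (a j * z + r / sigma) - Phi (a j * z) <= 2^-1 * (r / sigma).
    by have := @Phi_lipschitz R (a j * z) (a j * z + r / sigma); rewrite lerDl => /(_ r0); lra.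
  by move: h1 h2 rate; lra.
have mG : measurable (~` good) by exact: measurableC.
apply: (@le_trans _ _ (P W + P (~` good))%E).
  apply: le_trans (measureU2 _ mW mG); apply: le_measure; rewrite ?inE//.
  exact: measurableU.
rewrite EFinD; apply: leeD => //.
rewrite probability_setC// EFinB fineK//; exact: fin_num_measure.
Qed.

Unset Implicit Arguments.
Set Strict Implicit.
Set Printing Implicit Defensive.

Theorem theorem2 (R : realType)
  (p : nat -> nat) (hp : forall n, (0 < p n)%N)
  (X : forall n, 'M[R]_(n, p n)) (beta0 : forall n, 'cV[R]_(p n))
  (sigma : R) (hsigma : 0 < sigma)
  (d : nat -> measure_display) (T : forall n, measurableType (d n))
  (P : forall n, probability (T n) R)
  (eps : forall n, T n -> 'cV[R]_n)
  (heps : forall n, iid_normal (P n) (eps n) sigma)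
  (lam : nat -> R) (hlam : forall n, 0 < lam n)
  (G : forall n, 'M[R]_n) (hG : forall n, is_MP_inv (X n *m (X n)^T) (G n))
  (hOm : forall n, (0 < n)%N -> 0 < Omega_min (Omega (X n) (lam n)))
  (hrate : (fun n => Num.sqrt n%:R * norm2 (PX (X n) (G n) *m beta0 n) * lam n
              * (Num.sqrt (Omega_min (Omega (X n) (lam n))))^-1
              * (lambda_min_nz (Sigma_hat (X n)))^-1) @ \oo --> (0 : R))
  (binit : forall n, T n -> 'cV[R]_(p n))
  (hbinit : forall n j, measurable_fun setT (fun w => binit n w j 0))
  (Delta : forall n, 'I_(p n) -> R) (hDelta : forall n j, 0 < Delta n j)
  (hinit : (fun n => P n [set w | forall j : 'I_(p n),
       `| a_coef n sigma (Omega (X n) (lam n)) j *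
          \sum_(k | k != j) PX (X n) (G n) j k * (binit n w k 0 - beta0 n k 0) |
       <= Delta n j]) @ \oo --> 1%E)
  (dZ : nat -> measure_display) (TZ : forall n, measurableType (dZ n))
  (Q : forall n, probability (TZ n) R) (Z : forall n, TZ n -> 'cV[R]_(p n))
  (hZ : forall n, gaussian_vec (Q n) (Z n)
          (((n%:R)^-1 * sigma ^+ 2) *: Omega (X n) (lam n)))
  (zeta : R) (hzeta : 0 < zeta) :
  let Y n w := X n *m beta0 n + eps n w in
  let Pcorr n w j := FZ (Q n) (Z n) (a_coef n sigma (Omega (X n) (lam n)))
        (pval (X n) (G n) (lam n) sigma (Delta n) (Y n w) (binit n w) j + zeta) in
  (* the event |V_alpha| > 0 *)
  let Vpos n (alpha : R) := [set w | (0 < #|[set j : 'I_(p n) |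
        (beta0 n j 0 == 0)%R && (Pcorr n w j <= alpha)%R]|)%N] in
  (forall alpha : R, 0 < alpha < 1 ->
     (limn_esup (fun n => P n (Vpos n alpha)) <= alpha%:E)%E) /\
  (exists eta : nat -> R, eta @ \oo --> (0 : R) /\
     forall alpha : nat -> R, (forall n, 0 < alpha n < 1) ->
       alpha @ \oo --> (0 : R) -> (forall n, eta n <= alpha n) ->
       (limn_esup (fun n => P n (Vpos n (alpha n)) - (alpha n)%:E) <= 0)%E).
Proof.
move=> Y Pcorr Vpos.
pose good n := [set w | forall j : 'I_(p n), `| a_coef n sigma (Omega (X n) (lam n)) j *
  \sum_(k | k != j) PX (X n) (G n) j k * (binit n w k 0 - beta0 n k 0) | <= Delta n j].
pose u n := 1 - fine (P n (good n)).
have u0 : u @ \oo --> 0.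
  rewrite -[X in _ --> X](subrr 1); apply: cvgB; first exact: cvg_cst.
  exact: (fine_cvg hinit).
pose rate n := Num.sqrt n%:R * norm2 (PX (X n) (G n) *m beta0 n) * lam n
  * (Num.sqrt (Omega_min (Omega (X n) (lam n))))^-1 * (lambda_min_nz (Sigma_hat (X n)))^-1.
have VposE n alpha : Vpos n alpha = [set w | exists j, beta0 n j 0 = 0 /\ Pcorr n w j <= alpha].
  apply/seteqP; split => w /=.
    by move=> /card_gt0P[j]; rewrite inE => /andP[/eqP bj Pj]; exists j.
  by move=> [j [bj Pj]]; apply/card_gt0P; exists j; rewrite inE; apply/andP; split => //; exact/eqP.
(* [alpha] is quantified after [n], so one bound serves both a fixed level and a sequence of
   levels. *)
have bound : \forall n \near \oo, forall alpha, 0 <= alpha ->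
    (P n (Vpos n alpha) <= (alpha + u n)%:E)%E.
  near=> n => alpha a0; rewrite VposE.
  have n0 : (0 < n)%N by near: n; exact: nbhs_infty_gt.
  have rz : rate n / sigma <= zeta.
    rewrite ler_pdivrMr//; near: n.
    by apply: (cvgr_le _ hrate); rewrite mulr_gt0.
  by have [_] := family_error_le (Delta n) n0 hsigma (heps n) (hlam n) (hG n) (hOm n n0)
    (hbinit n) (hZ n) rz a0; exact.
split.
  move=> alpha /andP[a0 _]; apply: (limn_esup_le_add_cvg0 u0).
  by near=> n; apply: (near bound n) => //; exact: ltW.
exists (fun=> 0); split; first exact: cvg_cst.
move=> alpha a01 _ _; apply: (limn_esup_le_add_cvg0 u0).
near=> n; have /andP[a0 _] := a01 n.
rewrite leeBlDr// -EFinD add0r addrC.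
by apply: (near bound n) => //; exact: ltW.
Unshelve. all: by end_near. Qed.
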